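(* Let $a \geq 2$ be an integer and regard $S_a \wr S_n$ as a subgroup of $S_{an}$ (stabilizer of a partition of $\{1,\ldots,an\}$ into $n$ blocks of size $a$). (1) The proportion of elements of $S_{an}$ conjugate to an element of $S_a \wr S_n$ is at most the coefficient of $u^n$ in $$\exp\left(\sum_{k \geq 1} \frac{u^k}{a!}\left(\frac1k\right)\left(\frac1k+1\right)\cdots\left(\frac1k + a - 1\right)\right).$$ (2) For $a$ fixed and $n \to \infty$, the coefficient of $u^n$ in this power series is asymptotic to $$\frac{e^{\sum_{r=2}^a p(a,r)\zeta(r)}}{\Gamma(1/a)}\, n^{\frac1a - 1},$$ where $p(a,r)$ is the proportion of permutations in $S_a$ with exactly $r$ cycles, $\zeta$ is the Riemann zeta function and $\Gamma$ is the gamma function. *)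

(* Defs.v *)
From HB Require Import structures.
From mathcomp Require Import all_boot all_order all_algebra all_fingroup.
From mathcomp Require Import all_classical all_reals all_analysis.

Set Implicit Arguments.
Unset Strict Implicit.
Unset Printing Implicit Defensive.

Import Order.TTheory GRing.Theory Num.Theory.
Import numFieldNormedType.Exports.

Local Open Scope ring_scope.

Definition is_block_system (T : finType) (a n : nat) (P : {set {set T}}) : Prop :=
  [/\ finset.partition P (finset.setTfor T), #|P| = n
    & forall B, B \in P -> #|B| = a].

(* For a block system [P] of [n] blocks of size [a], this is S_a wr S_n
   inside Sym(T); ['P^*] is the action of permutations on subsets of [T]. *)
Definition block_stabilizer (T : finType) (P : {set {set T}}) : {set {perm T}} :=
  astabs P ('P^*)%act.

Definition conj_proportion (R : realType) (gT : finGroupType) (H : {set gT}) : R :=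
  #|class_support H (finset.setTfor gT)|%:R / #|gT|%:R.

(* [porbits s] includes the fixed points of [s] as singleton cycles. *)
Definition cycle_proportion (R : realType) (a r : nat) : R :=
  #|finset (fun s : 'S_a => #|porbits s| == r)|%:R / #|'S_a|%:R.

(* A formal power series over [R] is its coefficient sequence [nat -> R]. *)
Definition fps_one (R : realType) : nat -> R := fun n => (n == 0%N)%:R.

Definition fps_mul (R : realType) (f g : nat -> R) : nat -> R :=
  fun n => \sum_(i < n.+1) f i * g (n - i)%N.

Definition fps_pow (R : realType) (f : nat -> R) (m : nat) : nat -> R :=
  iter m (fps_mul f) (fps_one R).

(* exp(f) = sum_m f^m / m!, for [f] with zero constant term: then f^m has no
   u^n term when m > n, so the sum defining the n-th coefficient stops at n. *)
Definition fps_exp (R : realType) (f : nat -> R) : nat -> R :=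
  fun n => \sum_(m < n.+1) fps_pow f m n / m`!%:R.

Definition wreath_exponent (R : realType) (a : nat) : nat -> R :=
  fun k => if k == 0%N then 0
           else (a`!%:R)^-1 * \prod_(i < a) (k%:R^-1 + i%:R).

(* The Dirichlet series, meaningful for 1 < s. *)
Definition riemann_zeta (R : realType) (s : R) : R :=
  limn (series (fun k : nat => (k.+1%:R `^ s)^-1)).

(* Euler's integral, meaningful for 0 < x. *)
Definition euler_gamma (R : realType) (x : R) : R :=
  \int[lebesgue_measure]_(t in `]0, +oo[%classic) (t `^ (x - 1) * expR (- t)).

(* Main.v *)
(** (1) If s preserves a system of n blocks of size a, each orbit of s on the
    blocks has for union a set U of size k a, where k is the number of blocks in
    the orbit; all cycle lengths of s in U are divisible by k, and s preserves a
    system of n - k blocks off U. The coefficient w_k of u^k in the exponent is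
    the proportion of permutations of k a points whose cycle lengths are all
    divisible by k: by the exponential formula, it is the coefficient of u^(k a)
    in (1 - u^k)^(-1/k). As the values k add up to n over the orbits of s,
    counting pairs (s, U) shows that the proportion g_n of permutations that
    preserve some block system satisfies n g_n <= sum_k k w_k g_(n-k), whereas the
    coefficients c_n of the exponential satisfy this recursion with equality.

    (2) Since w_k = sum_r p(a,r) k^(-r) and p(a,1) = 1/a, the series is the product
    of (1 - u)^(-1/a) and of h = exp(sum_k v_k u^k), with v_k = O(k^(-2)), whose
    coefficients are nonnegative, have sum exp(sum_(r >= 2) p(a,r) zeta(r)), and are
    o(1/n). Hence c_n is equivalent to that sum times the n-th coefficient of
    (1 - u)^(-1/a), which is evaluated by Euler's limit
    Gamma(1/a) = lim a n^(1/a) prod_(1 <= i <= n) i / (i + 1/a); the latter follows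
    by dominated convergence from the integral of (1 - s^a/n)^n over [0, n^(1/a)]. *)

Require Import Defs.
From HB Require Import structures.
From mathcomp Require Import all_boot all_order all_algebra all_fingroup.
From mathcomp Require Import reals ring lra zify.

Set Implicit Arguments.
Unset Strict Implicit.
Unset Printing Implicit Defensive.

Import Order.TTheory GRing.Theory Num.Theory.

Local Open Scope ring_scope.

(** * Formal exponentials and their coefficient recursion *)

Section FormalPowerSeries.
Variable R : realType.
Implicit Types (f g : nat -> R) (m n k : nat).

(** Coefficients up to N depend only on the truncation at N, so the differentiation rules of
    polynomials carry over to series. *)
Lemma fps_pow_coef f m n N : (n <= N)%N ->
  fps_pow f m n = ((\poly_(i < N.+1) f i) ^+ m)`_n.
Proof.
elim: m n => [|m IHm] n le_nN; first by rewrite expr0 coef1.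
rewrite exprS coefM [LHS]/=; apply: eq_bigr => i _.
have le_iN : (i <= N)%N by apply: leq_trans le_nN; rewrite -ltnS.
rewrite coef_poly ltnS le_iN -IHm //.
exact: leq_trans (leq_subr _ _) le_nN.
Qed.

Lemma fps_pow_small f m n : f 0%N = 0 -> (n < m)%N -> fps_pow f m n = 0.
Proof.
move=> f0; elim: m n => [//|m IHm] n lt_nm /=.
apply: big1 => -[[|i] lt_i] _ /=; first by rewrite f0 mul0r.
by rewrite IHm ?mulr0 //; lia.
Qed.

(** Coefficient of u^n in u (f^(m+1))' = (m+1) (u f') f^m. *)
Lemma fps_pow_rec f m n : n%:R * fps_pow f m.+1 n =
  m.+1%:R * \sum_(k < n.+1) k%:R * f k * fps_pow f m (n - k).
Proof.
case: n => [|n]; first by rewrite big_ord1 !mul0r mulr0.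
rewrite (fps_pow_coef f m.+1 (leqnn n.+1)) mulr_natl -coef_deriv deriv_exp.
rewrite coefMn coefM [in RHS]big_ord_recl !mul0r add0r [RHS]mulr_natl.
congr (_ *+ _); apply: eq_bigr => i _; rewrite coef_deriv coef_poly lift0 ltnS.
rewrite ltn_ord mulr_natl; congr (_ * _).
by rewrite -fps_pow_coef ?subSS // ltnW // ltnS leq_subr.
Qed.

Lemma fps_exp_wide f n N : f 0%N = 0 -> (n <= N)%N ->
  fps_exp f n = \sum_(m < N.+1) fps_pow f m n / m`!%:R.
Proof.
move=> f0 le_nN; rewrite /fps_exp.
rewrite (big_ord_widen N.+1 (fun m => fps_pow f m n / m`!%:R)) ?ltnS //.
rewrite big_mkcond; apply: eq_bigr => m _; case: ltnP => // lt_nm.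
by rewrite fps_pow_small ?mul0r.
Qed.

Lemma fps_exp0 f : fps_exp f 0 = 1.
Proof. by rewrite /fps_exp big_ord1 /= divr1. Qed.

(** Coefficient form of u e' = (u f') e for e = exp(f): divide [fps_pow_rec] by (m+1)! and sum over
    m. *)
Lemma fps_exp_rec f n : f 0%N = 0 ->
  n%:R * fps_exp f n = \sum_(k < n.+1) k%:R * f k * fps_exp f (n - k).
Proof.
move=> f0; case: n => [|n]; first by rewrite big_ord1 !mul0r.
rewrite [RHS]big_ord_recl !mul0r add0r {1}/fps_exp [X in _ * X = _]big_ord_recl.
have -> : fps_pow f (@ord0 n.+1) n.+1 = 0 by [].
rewrite mul0r add0r.
under [RHS]eq_bigr => k _.
  rewrite lift0 subSS (@fps_exp_wide _ _ n) ?leq_subr // mulr_sumr.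
  over.
rewrite exchange_big mulr_sumr; apply: eq_bigr => m _.
rewrite lift0 mulrA fps_pow_rec [X in _ * X / _]big_ord_recl !mul0r add0r.
rewrite factS natrM -mulf_div divff ?pnatr_eq0 // mul1r mulr_suml.
by apply: eq_bigr => k _; rewrite lift0 subSS !mulrA.
Qed.

(** The term k = 0 of the recursion vanishes, so each coefficient is determined by the earlier
    ones. *)
Lemma fps_exp_unique f (e : nat -> R) : f 0%N = 0 -> e 0%N = 1 ->
    (forall n, n.+1%:R * e n.+1 = \sum_(k < n.+2) k%:R * f k * e (n.+1 - k)%N) ->
  e =1 fps_exp f.
Proof.
move=> f0 e0 e_rec n; elim/ltn_ind: n => -[|n] IHn; first by rewrite e0 fps_exp0.
have n_neq0 : n.+1%:R != 0 :> R by rewrite pnatr_eq0.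
apply: (mulfI n_neq0); rewrite e_rec fps_exp_rec //; apply: eq_bigr => -[[|k] lt_k] _ /=.
  by rewrite !mul0r.
by rewrite IHn //; lia.
Qed.

Lemma fps_mulC f g : fps_mul f g =1 fps_mul g f.
Proof.
move=> n; rewrite /fps_mul (reindex_inj rev_ord_inj); apply: eq_bigr => i _ /=.
by rewrite subSS subKn 1?mulrC // -ltnS.
Qed.

Lemma fps_mul_coef f g n N : (n <= N)%N ->
  fps_mul f g n = (\poly_(i < N.+1) f i * \poly_(i < N.+1) g i)`_n.
Proof.
move=> le_nN; rewrite coefM; apply: eq_bigr => i _.
have le_iN : (i <= N)%N by apply: leq_trans le_nN; rewrite -ltnS.
by rewrite !coef_poly !ltnS le_iN (leq_trans (leq_subr _ _) le_nN).
Qed.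

Lemma eq_fps_mul f f' g g' : f =1 f' -> g =1 g' -> fps_mul f g =1 fps_mul f' g'.
Proof. by move=> ff' gg' n; apply: eq_bigr => i _; rewrite ff' gg'. Qed.

Lemma fps_mulA f g h : fps_mul f (fps_mul g h) =1 fps_mul (fps_mul f g) h.
Proof.
move=> n; pose p u := \poly_(i < n.+1) u i : {poly R}.
have trE u v i : (i <= n)%N -> (p (fps_mul u v))`_i = (p u * p v)`_i.
  by move=> le_in; rewrite coef_poly ltnS le_in -fps_mul_coef.
rewrite !(@fps_mul_coef _ _ n n) // -/(p f) -/(p _) -/(p h) -/(p _).
transitivity (p f * (p g * p h))`_n; last rewrite mulrA.
all: rewrite !coefM; apply: eq_bigr => i _; rewrite ?trE ?leq_subr //.
by rewrite -ltnS.
Qed.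

Lemma fps_mulDl f f' g n :
  fps_mul (fun k => f k + f' k) g n = fps_mul f g n + fps_mul f' g n.
Proof. by rewrite /fps_mul -big_split; apply: eq_bigr => i _; rewrite mulrDl. Qed.

Lemma fps_mul_natl f g n : n%:R * fps_mul f g n =
  fps_mul (fun k => k%:R * f k) g n + fps_mul f (fun k => k%:R * g k) n.
Proof.
rewrite /fps_mul mulr_sumr -big_split; apply: eq_bigr => i _ /=.
by rewrite -{1}(@subnKC i n) -1?ltnS // natrD; ring.
Qed.

(** By the Leibniz rule [fps_mul_natl], the product satisfies the recursion that characterises the
    exponential of the sum. *)
Lemma fps_expD f g : f 0%N = 0 -> g 0%N = 0 ->
  fps_exp (fun n => f n + g n) =1 fps_mul (fps_exp f) (fps_exp g).
Proof.
move=> f0 g0 n; apply/esym; move: n.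
apply: fps_exp_unique; first by rewrite f0 g0 addr0.
  by rewrite /fps_mul big_ord1 !fps_exp0 mulr1.
move=> n.
have recE (u : nat -> R) k : u 0%N = 0 ->
    k%:R * fps_exp u k = fps_mul (fun j => j%:R * u j) (fps_exp u) k.
  by move=> u0; rewrite fps_exp_rec.
rewrite fps_mul_natl.
rewrite (eq_fps_mul (fun k => recE f k f0) (frefl _)).
rewrite (eq_fps_mul (frefl _) (fun k => recE g k g0)).
rewrite [X in _ + X]fps_mulC -!fps_mulA.
rewrite [X in _ + X](eq_fps_mul (frefl _) (fps_mulC (fps_exp g) (fps_exp f))).
rewrite -fps_mulDl; apply: eq_bigr => i _; congr (_ * _).
by rewrite mulrDr.
Qed.

(* This is the power series of (1 - u^k)^(-y/k). *)
Lemma fps_exp_log k (y : R) M : (0 < k)%N ->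
  fps_exp (fun j => (k %| j)%:R * y / j%:R) (k * M) =
  \prod_(i < M) (((k * i)%:R + y) / (k * i.+1)%:R).
Proof.
move=> k_gt0; set f := fun j : nat => _; set e := fps_exp f.
have f0 : f 0%N = 0 by rewrite /f invr0 mulr0.
have recE N : N%:R * e N = \sum_(j < N) (k %| j.+1)%:R * y * e (N - j.+1)%N.
  rewrite fps_exp_rec // big_ord_recl !mul0r add0r; apply: eq_bigr => j _.
  rewrite lift0 /f; congr (_ * _).
  by rewrite mulrC divfK // pnatr_eq0.
(* Among the first k terms of the recursion at N + k only j + 1 = k survives and gives y e_N; the
   remaining terms form the recursion at N. *)
have step N : (N + k)%:R * e (N + k)%N = (N%:R + y) * e N.
  have [k' kE] : exists k', k = k'.+1 by exists k.-1; lia.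
  rewrite recE addnC big_split_ord /= mulrDl recE addrC; congr (_ + _).
    apply: eq_bigr => j _; rewrite -addnS dvdn_addr // subnDl.
    by [].
  rewrite kE big_ord_recr /= big1 ?add0r => [|j _]; last first.
    by rewrite gtnNdvd ?mul0r // ltnS.
  by rewrite dvdnn mul1r addKn.
elim: M => [|M IHM]; first by rewrite muln0 big_ord0 /e fps_exp0.
rewrite big_ord_recr -IHM /=.
have n0 : (k * M.+1)%:R != 0 :> R by rewrite pnatr_eq0 -lt0n muln_gt0 k_gt0.
apply: (mulfI n0); rewrite [RHS]mulrC mulrA divfK //.
by rewrite mulnSr step mulrC.
Qed.

(** These are the coefficients of (1 - u)^(-y). *)
Lemma fps_exp_log1 (y : R) n :
  fps_exp (fun j => y / j%:R) n = \prod_(i < n) ((i%:R + y) / i.+1%:R).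
Proof.
have := @fps_exp_log 1 y n isT; rewrite mul1n.
have -> : (fun j => (1 %| j)%N%:R * y / j%:R) = (fun j => y / j%:R).
  by apply/boolp.funext => j; rewrite dvd1n mul1r.
by move=> ->; apply: eq_bigr => i _; rewrite !mul1n.
Qed.

End FormalPowerSeries.

(** * Splitting a permutation along a stable subset *)

Section PermutationSplitting.
Variable T : finType.
Implicit Types (A B C : {set T}) (s t y z : {perm T}).

Lemma stable_imset s B x : s @: B = B -> x \in B -> s x \in B.
Proof. by move=> sB xB; rewrite -sB imset_f. Qed.

Lemma eq_in_expg s t B i : {in B, s =1 t} -> s @: B = B ->
  {in B, forall x, (s ^+ i)%g x = (t ^+ i)%g x /\ (s ^+ i)%g x \in B}.
Proof.
move=> st sB x xB; elim: i => [|i [IHe IHm]]; first by rewrite !expg0 perm1.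
by rewrite !expgSr !permM -IHe -st //; split; rewrite // stable_imset.
Qed.

Lemma eq_in_porbit s t B : {in B, s =1 t} -> s @: B = B ->
  {in B, porbit s =1 porbit t}.
Proof.
move=> st sB x xB; apply/setP=> w; apply/porbitP/porbitP => -[i ->]; exists i.
  by have [] := eq_in_expg i st sB xB.
by have [->] := eq_in_expg i st sB xB.
Qed.

Lemma porbit_stable s B x : s @: B = B -> x \in B -> porbit s x \subset B.
Proof.
move=> sB xB; apply/subsetP=> w /porbitP[i ->].
by have [] := eq_in_expg i (fun x _ => erefl (s x)) sB xB.
Qed.

Lemma imset_porbit s x : s @: porbit s x = porbit s x.
Proof.
apply/eqP; rewrite eqEcard card_imset ?leqnn ?andbT; last exact: perm_inj.
apply/subsetP=> _ /imsetP[v /porbitP[i ->] ->].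
by rewrite -permM -expgSr mem_porbit.
Qed.

Lemma porbits_partition s A : s @: A = A -> partition (porbit s @: A) A.
Proof.
move=> sA; apply/and3P; split.
- rewrite cover_imset eqEsubset; apply/andP; split.
    by apply/bigcupsP => x xA; apply: porbit_stable.
  by apply/subsetP => x xA; apply/bigcupP; exists x => //; apply: porbit_id.
- apply/trivIsetP => _ _ /imsetP[x xA ->] /imsetP[w wA ->].
  apply: contraR => /pred0Pn[v /andP[/= vx vw]].
  by move: vx vw; rewrite -!eq_porbit_mem => /eqP<- /eqP->.
- apply/imsetP => -[x xA /setP/(_ x)]; by rewrite porbit_id inE.
Qed.

Lemma perm_on_setT s : perm_on [set: T] s.
Proof. by apply/subsetP => x; rewrite inE. Qed.

Lemma porbitsE s : porbits s = porbit s @: [set: T].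
Proof. by apply/setP => C; apply/imsetP/imsetP => -[x _ ->]; exists x. Qed.

Lemma porbits_partitionT s : partition (porbits s) [set: T].
Proof. by rewrite porbitsE porbits_partition // im_perm_on // perm_on_setT. Qed.

Lemma perm_on_mull A B y z : perm_on B y -> perm_on (A :\: B) z ->
  {in B, (y * z)%g =1 y}.
Proof.
move=> yB zAB x xB; rewrite permM (out_perm zAB) // inE.
by rewrite (perm_closed _ yB) xB.
Qed.

Lemma perm_on_mulr A B y z : perm_on B y -> perm_on (A :\: B) z ->
  {in A :\: B, (y * z)%g =1 z}.
Proof.
by move=> yB zAB x /setDP[_ xB]; rewrite permM (out_perm yB).
Qed.

Lemma imset_mul_perm_on A B y z : perm_on B y -> perm_on (A :\: B) z ->
  (y * z)%g @: B = B.
Proof.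
by move=> yB zAB; rewrite (eq_in_imset (perm_on_mull yB zAB)) im_perm_on.
Qed.

Lemma imset_mul_perm_onD A B y z : perm_on B y -> perm_on (A :\: B) z ->
  (y * z)%g @: (A :\: B) = A :\: B.
Proof.
by move=> yB zAB; rewrite (eq_in_imset (perm_on_mulr yB zAB)) im_perm_on.
Qed.

Lemma imset_perm_setD s A B : s @: A = A -> s @: B = B ->
  s @: (A :\: B) = A :\: B.
Proof.
move=> sA sB; apply/eqP; rewrite eqEcard card_imset; last exact: perm_inj.
rewrite leqnn andbT; apply/subsetP => _ /imsetP[x /setDP[xA xB] ->].
rewrite inE (stable_imset sA xA) andbT; apply: contra xB.
by rewrite -{1}sB => /imsetP[w wB /perm_inj->].
Qed.

(** A permutation of A that stabilizes B is in a unique way a product of a permutation of B and one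
    of A :\: B; the factors are recovered by restriction. *)
Lemma big_perm_split (V : nmodType) A B (phi : {perm T} -> V) : B \subset A ->
  \sum_(s | perm_on A s && (s @: B == B)) phi s =
  \sum_(y | perm_on B y) \sum_(z | perm_on (A :\: B) z) phi (y * z)%g.
Proof.
move=> sBA; rewrite pair_big /=.
have normE s (D : {set T}) : s @: D = D -> s \in ('N(D | 'P))%g.
  move=> sD; apply/astabsP => x; rewrite /= apermE.
  by apply/idP/idP => [|/(stable_imset sD)//]; rewrite -{1}sD => /imsetP[w wD /perm_inj->].
rewrite (reindex_onto (fun p : {perm T} * {perm T} => (p.1 * p.2)%g)
  (fun s => (restr_perm B s, restr_perm (A :\: B) s))) /=.
  apply: eq_bigl => -[y z] /=; apply/andP/andP => [[_ /eqP[<- <-]]|[yB zAB]].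
    by rewrite !restr_perm_on.
  have yzB := imset_mul_perm_on yB zAB.
  have yzD := imset_mul_perm_onD yB zAB.
  split; last first.
    rewrite xpair_eqE; apply/andP; split; apply/eqP/permP => x.
      have [xB|xB] := boolP (x \in B); last first.
        by rewrite (out_perm yB) // (out_perm (restr_perm_on _ _)).
      by rewrite restr_permE ?normE // (perm_on_mull yB zAB).
    have [xB|xB] := boolP (x \in A :\: B); last first.
      by rewrite (out_perm zAB) // (out_perm (restr_perm_on _ _)).
    by rewrite restr_permE ?normE // (perm_on_mulr yB zAB).
  rewrite yzB eqxx andbT; apply: perm_onM.
    exact: subset_trans yB sBA.
  exact: subset_trans zAB (subsetDl _ _).
move=> s /andP[sA /eqP sB]; apply/permP => x; rewrite permM.
have sD := imset_perm_setD (im_perm_on sA) sB.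
have [xB|xB] := boolP (x \in B).
  rewrite (restr_permE (normE _ _ sB) xB) (out_perm (restr_perm_on _ _)) //.
  by rewrite inE (stable_imset sB xB).
rewrite (out_perm (restr_perm_on B _)) //.
have [xA|xA] := boolP (x \in A :\: B); first by rewrite restr_permE ?normE.
rewrite (out_perm (restr_perm_on _ _)) // (out_perm sA) //.
by apply: contra xA => xA; rewrite inE xB.
Qed.

End PermutationSplitting.

(** * Exponential formula for permutations weighted by cycle lengths *)

Section CycleIndex.
Variables (R : realType) (T : finType).
Implicit Types (A B C : {set T}) (s t y z : {perm T}) (g : nat -> R).

Definition cycle_weight g A s : R := \prod_(C in porbit s @: A) g #|C|.

(** For indeterminate g this is #|A|! times the cycle index of the symmetric group of A. *)
Definition cycle_sum g A : R := \sum_(s | perm_on A s) cycle_weight g A s.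

Definition full_cycles C : {set {perm T}} :=
  [set s | perm_on C s & porbit s @: C == [set C]].

Lemma eq_cycle_weight g A s t : {in A, s =1 t} -> s @: A = A ->
  cycle_weight g A s = cycle_weight g A t.
Proof.
by move=> st sA; rewrite /cycle_weight (eq_in_imset (eq_in_porbit st sA)).
Qed.

Lemma cycle_weight_split g A B s : B \subset A -> s @: A = A -> s @: B = B ->
  cycle_weight g A s = cycle_weight g B s * cycle_weight g (A :\: B) s.
Proof.
move=> sBA sA sB; rewrite /cycle_weight -bigU /=.
  apply: eq_bigl => C; rewrite !inE -[in LHS](setID A B) (setIidPr sBA) imsetU.
  by rewrite inE.
apply/pred0Pn => -[C /= /andP[/imsetP[x xB ->] /imsetP[w wD /setP/(_ x)]]].
rewrite porbit_id => /esym /(subsetP (porbit_stable (imset_perm_setD sA sB) wD)).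
by rewrite inE xB.
Qed.

Lemma cycle_sum_one A : cycle_sum (fun=> 1) A = #|A|`!%:R.
Proof.
rewrite -card_perm -sum1_card natr_sum; apply: eq_bigr => s _.
by rewrite /cycle_weight big1.
Qed.

Lemma porbit_imset_full C s : C != set0 -> s @: C = C ->
  (porbit s @: C == [set C]) = (C \in porbit s @: C).
Proof.
move=> /set0Pn[x xC] sC; apply/eqP/idP => [->|]; first by rewrite inE.
case/imsetP => w wC CE; apply/setP => D; rewrite inE; apply/imsetP/eqP => [[v vC ->]|->].
  by apply/eqP; rewrite CE eq_porbit_mem -CE.
by exists w.
Qed.

(** The cycle lengths of s add up to #|A|, so the left side counts pairs of s and one of its cycles
    C with weight #|C|; then s splits into a full cycle on C and a permutation of the rest. *)
Lemma cycle_sum_rec g A : #|A|%:R * cycle_sum g A =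
  \sum_(C : {set T} | (C \subset A) && (C != set0))
     #|C|%:R * g #|C| * #|full_cycles C|%:R * cycle_sum g (A :\: C).
Proof.
rewrite mulr_sumr.
transitivity (\sum_(s | perm_on A s) \sum_(C in porbit s @: A)
    #|C|%:R * cycle_weight g A s).
  apply: eq_bigr => s sA; rewrite -mulr_suml; congr (_ * _).
  by rewrite (card_partition (porbits_partition (im_perm_on sA))) natr_sum.
pose P C := (C \subset A) && (C != set0).
rewrite (exchange_big_dep P) /=; last first.
  move=> s C sA /imsetP[x xA ->]; rewrite /P porbit_stable ?im_perm_on //=.
  by apply/set0Pn; exists x; rewrite porbit_id.
apply: eq_bigr => C /andP[sCA C0].
transitivity (\sum_(s | perm_on A s && (s @: C == C))
    (C \in porbit s @: C)%:R * (#|C|%:R * cycle_weight g A s)).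
  rewrite [LHS]big_mkcond [RHS]big_mkcond; apply: eq_bigr => s _ /=.
  have [sA|] := boolP (perm_on A s) => //=.
  have [sC|nsC] := eqVneq (s @: C) C; last first.
    case: ifP => // /imsetP[x _ CE]; by move: nsC; rewrite CE imset_porbit eqxx.
  case: ifPn => [/imsetP[x xA CE]|CA].
    rewrite (_ : C \in _) ?mul1r //; apply/imsetP; exists x => //.
    by rewrite CE porbit_id.
  rewrite (_ : (C \in _) = false) ?mul0r //; apply: contraNF CA.
  by apply: subsetP; apply: imsetS.
rewrite big_perm_split //.
transitivity (\sum_(y | perm_on C y) \sum_(z | perm_on (A :\: C) z)
    (#|C|%:R * g #|C| * (porbit y @: C == [set C])%:R) * cycle_weight g (A :\: C) z).
  apply: eq_bigr => y yC; apply: eq_bigr => z zAC.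
  have yzA : (y * z)%g @: A = A.
    apply: im_perm_on; apply: perm_onM.
      exact: subset_trans yC sCA.
    exact: subset_trans zAC (subsetDl _ _).
  have yzC := imset_mul_perm_on yC zAC.
  have yzD := imset_mul_perm_onD yC zAC.
  have yzl := perm_on_mull yC zAC.
  have yzr := perm_on_mulr yC zAC.
  rewrite (cycle_weight_split _ sCA) // (eq_cycle_weight _ yzl) //.
  rewrite (eq_cycle_weight _ yzr) // (eq_in_imset (eq_in_porbit yzl yzC)).
  rewrite -porbit_imset_full ?im_perm_on //.
  have [yF|_] := eqVneq; last by rewrite !mul0r mulr0 mul0r.
  by rewrite /cycle_weight yF big_set1 /=; ring.
have -> : #|full_cycles C|%:R = \sum_(y | perm_on C y) (porbit y @: C == [set C])%:R :> R.
  rewrite -sum1_card natr_sum big_mkcond [RHS]big_mkcond; apply: eq_bigr => y _.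
  by rewrite inE; case: (perm_on C y) => //; case: eqP.
rewrite [X in _ = X * _]mulr_sumr mulr_suml; apply: eq_bigr => y _.
by rewrite -mulr_sumr.
Qed.

Lemma sum_subset_card (V : nmodType) A (phi : nat -> V) :
  \sum_(C : {set T} | (C \subset A) && (C != set0)) phi #|C| =
  \sum_(j < #|A|) phi j.+1 *+ 'C(#|A|, j.+1).
Proof.
(* As #|C| <= #|A|, [inord] never takes its default value here; the class of index 0 is empty
   because C is nonempty. *)
rewrite (partition_big (fun C : {set T} => inord #|C| : 'I_#|A|.+1) xpredT) //=.
have inordE (C : {set T}) : C \subset A -> (inord #|C| : 'I_#|A|.+1) = #|C| :> nat.
  by move=> sCA; rewrite /= inordK // ltnS subset_leq_card.
rewrite big_ord_recl big_pred0 ?add0r => [|C]; last first.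
  apply/negbTE; apply/negP => /andP[/andP[sCA C0] /eqP/(congr1 (@nat_of_ord _))].
  by rewrite inordE // => /eqP; rewrite cards_eq0 (negbTE C0).
apply: eq_bigr => j _; rewrite -cards_draws -sumr_const; apply: eq_big => [C|C].
  rewrite inE; have [sCA|//] := boolP (C \subset A).
  rewrite -[inord _ == _](inj_eq val_inj) /= inordE // /bump add1n; have [->|//] := eqVneq C set0.
  by rewrite cards0.
by move=> /andP[/andP[sCA _] /eqP/(congr1 (@nat_of_ord _))]; rewrite inordE // => ->.
Qed.

(** Induction on the size, from [cycle_sum_rec] with weight 1, whose cycle sums are factorials: all
    terms but C = A are known, so the last one is forced. *)
Lemma card_full_cycles C : C != set0 -> #|full_cycles C| = (#|C|.-1)`!.
Proof.
have [n] := ubnP #|C|; elim: n C => // n IHn A /ltnSE le_An A0.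
have A_gt0 : (0 < #|A|)%N by rewrite card_gt0.
pose phi j : R := j%:R * 1 * (j.-1)`!%:R * (#|A| - j)`!%:R.
have := cycle_sum_rec (fun=> 1) A; have := sum_subset_card A phi.
rewrite (bigD1 A) /= ?subxx //= => E1; rewrite (bigD1 A) /= ?subxx //=.
rewrite [X in _ + X](eq_bigr (fun C : {set T} => phi #|C|)); last first.
  move=> C /andP[/andP[sCA C0] CA].
  rewrite IHn ?cycle_sum_one ?cardsD ?(setIidPr sCA) //.
  apply: leq_trans le_An; apply: proper_card.
  by rewrite properEneq CA.
rewrite setDv !cycle_sum_one cards0 mulr1.
(* Each of the #|A| terms on the right equals #|A|!. *)
have -> : #|A|%:R * #|A|`!%:R = \sum_(j < #|A|) phi j.+1 *+ 'C(#|A|, j.+1).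
  rewrite (eq_bigr (fun=> #|A|`!%:R)) ?sumr_const ?card_ord ?mulr_natl // => j _.
  rewrite /phi mulr1 -natrM -natrM -mulrnA mulnC.
  by rewrite -(bin_fact (ltn_ord j)) /= -factS.
rewrite -E1 /phi subnn => /addIr; rewrite !mulr1 => /mulfI E2.
by apply/eqP; rewrite -(eqr_nat R) E2 // pnatr_eq0 -lt0n.
Qed.

(** Exponential formula: once the cycles C are grouped by size, [cycle_sum_rec] becomes the
    recursion [fps_exp_rec]. *)
Lemma cycle_sum_exp g A :
  cycle_sum g A = #|A|`!%:R * fps_exp (fun j => g j / j%:R) #|A|.
Proof.
(* The constant term is 0 whatever [g 0] is, since 0^-1 = 0. *)
set f := fun j => _; have f0 : f 0%N = 0 by rewrite /f invr0 mulr0.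
have [n] := ubnP #|A|; elim: n A => // n IHn A /ltnSE le_An.
have [A0|A0] := eqVneq #|A| 0%N.
  move/eqP: (A0); rewrite cards_eq0 A0 fps_exp0 mulr1 => /eqP ->.
  have := cycle_sum_one set0; rewrite cards0 => <-; apply: eq_bigr => s _.
  by rewrite /cycle_weight imset0 !big_set0.
have nz : #|A|%:R != 0 :> R by rewrite pnatr_eq0.
apply: (mulfI nz); rewrite cycle_sum_rec mulrCA fps_exp_rec // big_ord_recl !mul0r add0r.
pose phi j := j%:R * g j * (j.-1)`!%:R * ((#|A| - j)`!%:R * fps_exp f (#|A| - j)).
rewrite (eq_bigr (fun C : {set T} => phi #|C|)) => [|C /andP[sCA C0]]; last first.
  rewrite card_full_cycles // IHn ?cardsD ?(setIidPr sCA) //.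
  by apply: leq_trans le_An; rewrite ltn_subrL !card_gt0 C0 -cards_eq0.
rewrite sum_subset_card mulr_sumr; apply: eq_bigr => j _.
rewrite lift0 /phi /f -(bin_fact (ltn_ord j)) factS !natrM /=.
have nzj : j.+1%:R != 0 :> R by rewrite pnatr_eq0.
by rewrite -[LHS]mulr_natl; field; rewrite nat1r.
Qed.

Definition div_cycles (k : nat) A : {set {perm T}} :=
  [set s | perm_on A s & [forall C in porbit s @: A, (k %| #|C|)%N]].

(** By [fps_exp_log] with y = 1 the coefficient is the product of the (k i + 1) / (k (i + 1)), that
    is, of the (i + 1/k) / (i + 1). *)
Lemma wreath_exponent_log a k : (0 < k)%N -> wreath_exponent R a k =
  fps_exp (fun j => (k %| j)%N%:R * 1 / j%:R) (k * a).
Proof.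
move=> k_gt0; rewrite fps_exp_log // /wreath_exponent gtn_eqF //.
elim: a => [|a IHa]; first by rewrite !big_ord0 fact0 invr1 mul1r.
rewrite !big_ord_recr /= -IHa factS !natrM invfM.
have : k%:R != 0 :> R by rewrite pnatr_eq0 -lt0n.
have : a.+1%:R != 0 :> R by rewrite pnatr_eq0.
have : a`!%:R != 0 :> R by rewrite pnatr_eq0 -lt0n fact_gt0.
by move=> nz1 nz2 nz3; field; rewrite nat1r nz1 nz2 nz3.
Qed.

(** Exponential formula with g the indicator of the multiples of k: the weight of s is then 1 or 0
    according to whether k divides all its cycle lengths. *)
Lemma card_div_cycles a k A : (0 < k)%N -> #|A| = (k * a)%N ->
  #|div_cycles k A|%:R = (k * a)`!%:R * wreath_exponent R a k.
Proof.
move=> k_gt0 Aka; rewrite wreath_exponent_log // -Aka.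
rewrite -(cycle_sum_exp (fun j => (k %| j)%N%:R * 1)) -sum1_card natr_sum.
under eq_bigl do rewrite inE; rewrite big_mkcondr; apply: eq_bigr => s _.
case: ifPn => [/forall_inP sA|].
  by rewrite /cycle_weight big1 // => C /sA ->; rewrite mulr1.
rewrite negb_forall_in => /existsP[C /andP[CA nkC]].
by rewrite /cycle_weight (bigD1 C) //= (negbTE nkC) !mul0r.
Qed.

Lemma sum_multiples (V : nmodType) a n (psi : nat -> V) : (0 < a)%N ->
  \sum_(j < a * n | (a %| j.+1)%N) psi (j.+1 %/ a)%N = \sum_(k < n) psi k.+1.
Proof.
move=> a_gt0; elim: n => [|n IHn]; first by rewrite muln0 !big_ord0.
rewrite big_mkcond mulnSr big_split_ord /= -big_mkcond IHn big_ord_recr /=; congr (_ + _).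
case: a a_gt0 {IHn} => // a _; rewrite big_ord_recr /= -addnS -mulnSr dvdn_mulr // mulKn //.
rewrite big1 ?add0r // => j _.
by rewrite -addnS dvdn_addr ?dvdn_mulr // gtnNdvd // ltnS.
Qed.

End CycleIndex.

(** * Orbits of a permutation on the blocks it preserves *)

Section BlockSystems.
Variable T : finType.
Implicit Types (A B C U : {set T}) (s t : {perm T}) (a : nat).

(** Stated relative to a subset A, so that an orbit of blocks can be removed and the rest treated by
    induction. *)
Definition blockable a A s := [exists P : {set {set T}},
  partition P A && [forall B in P, (#|B| == a) && (s @: B \in P)]].

Lemma eq_blockable a A s t : {in A, s =1 t} -> blockable a A s = blockable a A t.
Proof.
move=> st; apply: eq_existsb => P; have [partP|//] := boolP (partition P A).
apply: eq_forallb_in => B BP; rewrite (eq_in_imset (g := t)) // => x xB.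
by apply: st; apply: (subsetP (partitionS partP BP)).
Qed.

(** The remainder of m modulo the orbit length also fixes x, and the iterates of x below that length
    are distinct, so the remainder is 0. *)
Lemma porbit_dvd (X : finType) (s : {perm X}) x m :
  (s ^+ m)%g x = x -> (#|porbit s x| %| m)%N.
Proof.
set d := #|_|; have d_gt0 : (0 < d)%N by rewrite lt0n card_porbit_neq0.
have sd : (s ^+ d)%g x = x by rewrite permX iter_porbit.
have sdq q : (s ^+ (q * d))%g x = x.
  by elim: q => [|q IHq]; rewrite ?perm1 // mulSn expgD permM sd.
rewrite {1}(divn_eq m d) expgD permM sdq => sr; apply: contraT => r0.
have r_lt : (m %% d < d)%N by rewrite ltn_mod.
have : (nth x (traject s x d) 0 == nth x (traject s x d) (m %% d)) = (0 == m %% d)%N.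
  by apply: nth_uniq; rewrite ?size_traject // uniq_traject_porbit.
rewrite !nth_traject // -[iter (m %% d)%N s x]permX sr eqxx => /esym/eqP r_eq0.
by rewrite /dvdn -r_eq0 in r0.
Qed.

Lemma partitionD (P O : {set {set T}}) A : partition P A -> O \subset P ->
  partition (P :\: O) (A :\: cover O).
Proof.
move=> /and3P[/eqP <- tiP P0] sOP; apply/and3P; split.
- apply/eqP/setP => x; rewrite inE; apply/bigcupP/andP.
    case=> B /setDP[BP BO] xB; split; last by apply/bigcupP; exists B.
    apply/bigcupP => -[C CO xC]; move: BO.
    by rewrite -(def_pblock tiP BP xB) (def_pblock tiP (subsetP sOP _ CO) xC) CO.
  case=> xO /bigcupP[B BP xB]; exists B => //; rewrite inE BP andbT.
  by apply: contra xO => BO; apply/bigcupP; exists B.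
- exact: trivIsetD.
- by rewrite inE negb_and P0 orbT.
Qed.

(* Each orbit of s on the blocks of a preserved system contributes its union U,
   and #|U| %/ a is the number of blocks in the orbit. *)
Lemma blockable_orbits a A s : (0 < a)%N -> blockable a A s ->
  (#|A| %/ a <= \sum_(U : {set T} | [&& (U \subset A) && (U != set0),
      s @: U == U, (a %| #|U|)%N,
         [forall C in porbit s @: U, (#|U| %/ a %| #|C|)%N]
      & blockable a (A :\: U) s]) #|U| %/ a)%N.
Proof.
move=> a_gt0 /existsP[P /andP[partP /forall_inP blockP]].
have cardP B : B \in P -> #|B| = a by case/blockP/andP=> /eqP.
have imP B : B \in P -> s @: B \in P by case/blockP/andP.
have tiP := partition_trivIset partP.
pose t : {perm {set T}} := perm (imset_inj (@perm_inj _ s)).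
have tE B : t B = s @: B by rewrite permE.
have tX i B : (t ^+ i)%g B = (s ^+ i)%g @: B.
  elim: i => [|i IHi]; first by rewrite !expg0 perm1 (eq_imset _ (@perm1 T)) imset_id.
  rewrite !expgSr permM IHi tE -imset_comp; apply: eq_imset => x /=.
  by rewrite permM.
have tP : t @: P = P.
  apply/eqP; rewrite eqEcard card_imset ?leqnn ?andbT; last exact: perm_inj.
  by apply/subsetP => _ /imsetP[B BP ->]; rewrite tE imP.
have partQ := porbits_partition tP.
(* Distinct orbits of blocks have distinct unions, so the sum over orbits can be indexed by the
   unions. *)
have [_ cover_inj] := partition_partition partP partQ.
have cardcov (O : {set {set T}}) : O \subset P -> #|cover O| = (#|O| * a)%N.
  move=> sOP; apply: card_uniform_partition => [B /(subsetP sOP)/cardP//|].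
  rewrite /partition eqxx (trivIsetS sOP tiP) /=; apply: contra (subsetP sOP _) _.
  by rewrite (partition0 partP).
rewrite -(cover_partition partP) cardcov // mulnK // (card_partition partQ).
have QP O : O \in porbit t @: P -> O \subset P by apply: partitionS partQ.
rewrite (eq_bigr (fun O : {set {set T}} => #|cover O| %/ a)%N); last first.
  by move=> O /QP sOP; rewrite cardcov // mulnK.
rewrite -(big_imset (fun U : {set T} => #|U| %/ a)%N cover_inj) /=.
(* It is enough that every such union satisfies the conditions on the right; other sets U only
   increase the sum. *)
rewrite big_mkcond [leqRHS]big_mkcond; apply: leq_sum => U _.
case: ifP => // /imsetP[O OQ UE]; rewrite ifT //.
have sOP := QP O OQ; have [B BP OE] := imsetP OQ.
have UA : U \subset cover P.
  by rewrite UE; apply/bigcupsP => C CO; apply: bigcup_max (subsetP sOP _ CO) _.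
have BO : B \in O by rewrite OE porbit_id.
have tO : t @: O = O by rewrite OE imset_porbit.
rewrite UE; apply/and5P; split.
- rewrite -UE UA /= UE -card_gt0 cardcov // muln_gt0 a_gt0 andbT card_gt0.
  by apply/set0Pn; exists B.
- rewrite imset_cover -(eq_bigr _ (fun B _ => tE B)) -cover_imset.
  by rewrite tO.
- by rewrite cardcov // dvdn_mull.
- apply/forall_inP => _ /imsetP[x /bigcupP[D DO xD] ->].
  rewrite cardcov // mulnK //.
  have -> : O = porbit t D.
    by rewrite OE; apply/eqP; rewrite eq_sym eq_porbit_mem -OE.
  (* With m the length of the cycle of x, s^m maps D to a block that still contains x, hence to D;
     so the orbit length of D divides m. *)
  apply: porbit_dvd; set m := #|_|.
  have DP := subsetP sOP _ DO.
  have tmP : (t ^+ m)%g D \in P.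
    by have [] := eq_in_expg m (fun x _ => erefl (t x)) tP DP.
  rewrite -[RHS](def_pblock tiP DP xD); apply/esym; apply: def_pblock => //.
  by rewrite tX; apply/imsetP; exists x => //; rewrite permX iter_porbit.
- apply/existsP; exists (P :\: O); rewrite -UE (cover_partition partP) UE partitionD //=.
  apply/forall_inP => C CPO; have [CP _] := setDP CPO.
  rewrite cardP // eqxx /= -tE.
  exact: stable_imset (imset_perm_setD tP tO) CPO.
Qed.

End BlockSystems.

(** * Upper bound for the number of permutations preserving a block system *)

Section WreathBound.
Variables (R : realType) (T : finType).
Implicit Types (A B C U : {set T}) (s : {perm T}) (a : nat).

(** Double counting of the pairs (s, U) with weight the number of blocks in U; the resulting bound
    is the recursion of the coefficients. *)
Lemma card_blockable_le a n A : (0 < a)%N -> #|A| = (a * n)%N ->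
  #|[set s | perm_on A s & blockable a A s]|%:R
    <= (a * n)`!%:R * fps_exp (wreath_exponent R a) n.
Proof.
move=> a_gt0; elim/ltn_ind: n A => -[|n] IHn A cardA.
  rewrite fps_exp0 mulr1 ler_nat -cardA -card_perm; apply: subset_leq_card.
  by apply/subsetP => s; rewrite inE => /andP[].
pose w := wreath_exponent R a; pose c := fps_exp w.
pose good B := [set s | perm_on B s & blockable a B s].
pose ok U s := [&& s @: U == U, (a %| #|U|)%N,
  [forall C in porbit s @: U, (#|U| %/ a %| #|C|)%N] & blockable a (A :\: U) s].
have n_gt0 : 0 < n.+1%:R :> R by rewrite ltr0n.
rewrite -(ler_pM2l n_gt0) -/w -/c -/(good A).
(* By [blockable_orbits], every good s has total weight at least n + 1. *)
have le1 : n.+1%:R * #|good A|%:R <= \sum_(s in good A)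
    \sum_(U : {set T} | [&& (U \subset A) && (U != set0) & ok U s]) (#|U| %/ a)%:R :> R.
  rewrite -natrM mulnC -sum_nat_const natr_sum; apply: ler_sum => s.
  rewrite inE => /andP[_ /(blockable_orbits a_gt0)].
  by rewrite cardA mulKn // -natr_sum ler_nat.
pose P U := (U \subset A) && (U != set0).
(* [phi j] bounds the contribution of a set U of size j = k a: k times the number of permutations of
   U with cycle lengths divisible by k, times the inductive bound off U. *)
pose phi j : R := if (a %| j)%N then (j %/ a)%:R * (j`!%:R * w (j %/ a)%N) *
   ((a * n.+1 - j)`!%:R * c (n.+1 - j %/ a)%N) else 0.
have le2 : \sum_(s in good A) \sum_(U | P U && ok U s) (#|U| %/ a)%:R
    <= \sum_(U | P U) phi #|U|.
  rewrite (exchange_big_dep P) /=; last by move=> s U _ /andP[].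
  apply: ler_sum => U PU; have [sUA U0] := andP PU; rewrite /phi.
  case: ifPn => [aU|aU]; last first.
    by rewrite big_pred0 // => s; rewrite /ok (negbTE aU) /= !andbF.
  set k := (#|U| %/ a)%N; have Uk : #|U| = (k * a)%N by rewrite divnK.
  have k_gt0 : (0 < k)%N by rewrite divn_gt0 // dvdn_leq // card_gt0.
  have kn : (k <= n.+1)%N.
    by rewrite -(leq_pmul2l a_gt0) -cardA mulnC -Uk subset_leq_card.
  have cardD : #|A :\: U| = (a * (n.+1 - k))%N.
    by rewrite cardsD (setIidPr sUA) Uk cardA mulnBr (mulnC k).
  apply: (@le_trans _ _ (k%:R * #|div_cycles k U|%:R * #|good (A :\: U)|%:R)); last first.
    have -> : #|U|`!%:R * w k = #|div_cycles k U|%:R.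
      by rewrite (card_div_cycles R k_gt0 Uk) Uk.
    apply: ler_wpM2l; first by rewrite mulr_ge0 ?ler0n.
    rewrite Uk (mulnC k) -mulnBr; apply: IHn => //.
    by rewrite ltn_subrL k_gt0.
  pose dv s := [forall C in porbit s @: U, (k %| #|C|)%N].
  (* The requirement that s be good on A is dropped; the rest concerns separately the restrictions
     of s to U and to A :\: U, so the count factors. *)
  apply: (@le_trans _ _ (\sum_(s | perm_on A s && (s @: U == U))
      k%:R * (dv s)%:R * (blockable a (A :\: U) s)%:R)).
    rewrite [leLHS]big_mkcond [leRHS]big_mkcond; apply: ler_sum => s _.
    rewrite inE /ok -/k -/(dv s) PU aU /=.
    case: (perm_on A s) => //=; case: (s @: U == U); rewrite ?andbF //=.
    case: (dv s); case: (blockable a (A :\: U) s); case: (blockable a A s) => //=;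
      by rewrite ?mulr1 ?mulr0 ?mul0r ?ler0n.
  rewrite big_perm_split //.
  have cardE (Q S : pred {perm T}) :
      #|[set s | Q s & S s]|%:R = \sum_(s | Q s) (S s)%:R :> R.
    rewrite -sum1_card natr_sum big_mkcond [RHS]big_mkcond; apply: eq_bigr => s _.
    by rewrite inE; case: (Q s); case: (S s).
  rewrite /div_cycles /good !cardE -mulrA mulr_suml mulr_sumr; apply: ler_sum => y yU.
  rewrite !mulr_sumr; apply: ler_sum => z zAU.
  rewrite /dv (eq_in_imset (eq_in_porbit (perm_on_mull yU zAU) _)) ?(imset_mul_perm_on yU zAU) //.
  by rewrite (eq_blockable _ (perm_on_mulr yU zAU)) mulrA.
apply: le_trans le1 _; apply: le_trans le2 _.
(* Grouping the sets U by size j, their number times j! (a (n+1) - j)! is (a (n+1))!, which leaves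
   the recursion of [c]. *)
rewrite sum_subset_card cardA mulrCA fps_exp_rec; last by rewrite /w /wreath_exponent.
rewrite big_ord_recl !mul0r add0r.
rewrite -(sum_multiples _ (fun k => k%:R * w k * c (n.+1 - k)%N) a_gt0).
rewrite mulr_sumr [leRHS]big_mkcond; apply: ler_sum => j _.
rewrite /phi; case: ifP => aj; last by rewrite mul0rn.
rewrite -(bin_fact (ltn_ord j)) !natrM -mulr_natl.
by rewrite le_eqVlt; apply/orP; left; apply/eqP; ring.
Qed.

(** If h preserves P, its conjugate by g preserves the image of P under g. *)
Lemma class_support_blockable a n (P : {set {set T}}) : is_block_system a n P ->
  class_support (block_stabilizer P) [set: {perm T}]
    \subset [set s | perm_on [set: T] s & blockable a [set: T] s].
Proof.
case=> partP _ cardP; apply/subsetP => _ /imset2P[h g hP _ ->].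
rewrite inE perm_on_setT /=.
apply/existsP; exists [set g @: (B : {set T}) | B in P]; apply/andP; split.
  have gT : g @: [set: T] = [set: T] by apply: im_perm_on; apply: perm_on_setT.
  by rewrite -[X in partition _ X]gT imset_partition //; apply: perm_inj.
apply/forall_inP => _ /imsetP[B BP ->].
rewrite card_imset ?(cardP B BP) ?eqxx /=; last exact: perm_inj.
apply/imsetP; exists (h @: B); last first.
  by rewrite -!imset_comp; apply: eq_imset => x /=; rewrite permJ.
by have := astabs_act B hP; rewrite BP.
Qed.

Lemma conj_proportion_le a n (P : {set {set T}}) : (0 < a)%N -> #|T| = (a * n)%N ->
  is_block_system a n P ->
  conj_proportion R (block_stabilizer P) <= fps_exp (wreath_exponent R a) n.
Proof.
move=> a_gt0 cardT /class_support_blockable sub.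
have cardTT : #|[set: T]| = (a * n)%N by rewrite cardsT.
have cardS : #|{perm T}| = (a * n)`!.
  rewrite -cardTT -card_perm; apply: eq_card => s.
  by rewrite !inE [RHS]perm_on_setT.
rewrite /conj_proportion cardS ler_pdivrMr ?ltr0n ?fact_gt0 // mulrC.
apply: le_trans (card_blockable_le a_gt0 cardTT); rewrite ler_nat.
exact: subset_leq_card.
Qed.

End WreathBound.

(** * The exponent as a polynomial in 1/k *)

Section CycleProportions.
Variable R : realType.

(** With constant weight x = 1/k, the exponential formula evaluates the sum of x^(number of cycles)
    over the symmetric group as x (x + 1) ... (x + a - 1). *)
Lemma wreath_exponent_cycle_proportion a k : (0 < a)%N -> (0 < k)%N ->
  wreath_exponent R a k =
  \sum_(1 <= r < a.+1) cycle_proportion R a r * k%:R^-1 ^+ r.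
Proof.
case: a => // a _ k_gt0; set x : R := k%:R^-1.
have fact0 : a.+1`!%:R != 0 :> R by rewrite pnatr_eq0 -lt0n fact_gt0.
have cycE : \sum_(s : 'S_a.+1) x ^+ #|porbits s| = a.+1`!%:R * wreath_exponent R a.+1 k.
  transitivity (cycle_sum (fun=> x) [set: 'I_a.+1]).
    apply: eq_big => [s|s _]; first by rewrite perm_on_setT.
    by rewrite /cycle_weight prodr_const porbitsE.
  rewrite cycle_sum_exp cardsT card_ord fps_exp_log1.
  rewrite /wreath_exponent gtn_eqF // prodf_div mulrC fact_prod big_add1 big_mkord.
  rewrite natr_prod mulrC; congr (_ * _); rewrite mulrC; congr (_ * _).
  by apply: eq_bigr => i _; rewrite addrC.
apply: (mulfI fact0); rewrite -cycE mulr_sumr.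
have cyc_bound (s : 'S_a.+1) : (0 < #|porbits s| <= a.+1)%N.
  apply/andP; split.
    by rewrite card_gt0 porbitsE imset_eq0 -card_gt0 cardsT card_ord.
  by rewrite porbitsE (leq_trans (leq_imset_card _ _)) // cardsT card_ord.
rewrite big_add1 big_mkord /=.
rewrite (partition_big (fun s : 'S_a.+1 => inord #|porbits s|.-1 : 'I_a.+1) xpredT) //=.
apply: eq_bigr => r _.
rewrite /cycle_proportion card_Sn mulrA [X in X * _]mulrC divfK // mulr_natl -sumr_const.
apply: eq_big => s; rewrite ?inE; have /andP[c_gt0 c_le] := cyc_bound s.
  rewrite -val_eqE /= inordK ?prednK //.
  by rewrite -(inj_eq succn_inj) prednK.
by move/eqP/(congr1 val) => /=; rewrite inordK ?prednK // => <-; rewrite prednK.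
Qed.

(** The permutations with a single cycle are the (a - 1)! full cycles. *)
Lemma cycle_proportion1 a : (0 < a)%N -> cycle_proportion R a 1 = a%:R^-1.
Proof.
move=> a_gt0; have T0 : [set: 'I_a] != set0 by rewrite -card_gt0 cardsT card_ord.
rewrite /cycle_proportion card_Sn.
have -> : finset (fun s : 'S_a => #|porbits s| == 1%N) = full_cycles [set: 'I_a].
  apply/setP => s; rewrite !inE perm_on_setT -porbitsE.
  apply/cards1P/eqP => [[C CE]|->]; last by exists [set: 'I_a].
  by have /cover_partition := porbits_partitionT s; rewrite CE cover1 => ->.
rewrite (card_full_cycles R T0) cardsT card_ord.
case: a a_gt0 {T0} => // a _; rewrite factS natrM invfM mulrCA divff ?mulr1 //.
by rewrite pnatr_eq0 -lt0n fact_gt0.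
Qed.

End CycleProportions.

From mathcomp Require Import all_classical all_reals all_analysis.
From mathcomp Require Import measurable_realfun.

Import Order.TTheory GRing.Theory Num.Theory.
Import numFieldNormedType.Exports.

Local Open Scope classical_set_scope.
Local Open Scope ring_scope.

(** * Limits of sums of growing length *)

Section SummationLemmas.
Variable R : realType.
Implicit Types (u W : nat -> nat -> R) (f g h l q : nat -> R).

Lemma cvg_addn_shift j (f g : nat -> R) (L : R) : (forall n, g (n + j)%N = f n) ->
  f n @[n --> \oo] --> L -> g n @[n --> \oo] --> L.
Proof.
move=> gf fL; rewrite -(cvg_shiftn j).
by rewrite (_ : [sequence _]_n = f) //; apply/funext.
Qed.

Lemma eq_cvg_pos (f g : nat -> R) (L M : R) : L = M ->
  (forall n, (0 < n)%N -> f n = g n) ->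
  f n @[n --> \oo] --> L -> g n @[n --> \oo] --> M.
Proof.
move=> <- fg; apply: cvg_trans; apply: near_eq_cvg; near=> n.
by apply: fg; near: n; exists 1%N.
Unshelve. all: by end_near. Qed.

Lemma cvg_sum_seq (I : Type) (r : seq I) (P : pred I) (F : I -> nat -> R) (l : I -> R) :
    (forall i, P i -> F i n @[n --> \oo] --> l i) ->
  (\sum_(i <- r | P i) F i n) @[n --> \oo] --> \sum_(i <- r | P i) l i.
Proof.
move=> Fl; elim: r => [|i r IHr].
  by rewrite big_nil; under eq_fun do rewrite big_nil; apply: cvg_cst.
rewrite big_cons; under eq_fun do rewrite big_cons.
by case: ifP => // Pi; apply: cvgD => //; apply: Fl.
Qed.

(** Cut at J: the head is a fixed finite sum of null sequences, the tail is uniformly small. The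
    offset d serves the upper bounds n and n + 1. *)
Lemma cvg_sum_uniform_tail d u :
    (forall j, u n j @[n --> \oo] --> (0 : R)) ->
    (forall e : R, 0 < e ->
       exists J, forall n, \sum_(J <= j < d + n) `|u n j| <= e) ->
  (\sum_(0 <= j < d + n) u n j) @[n --> \oo] --> (0 : R).
Proof.
move=> u0 utail; apply/cvgr0Pnorm_lt => e e_gt0.
have e2_gt0 : 0 < e / 2 by rewrite divr_gt0.
have [J tailJ] := utail (e / 2) e2_gt0.
have headJ : (\sum_(0 <= j < J) `|u n j|) @[n --> \oo] --> (0 : R).
  rewrite [X in _ --> X](_ : _ = \sum_(0 <= j < J) 0); last by rewrite big1.
  by apply: cvg_sum_seq => j _; rewrite -(normr0 R); apply: cvg_norm; apply: u0.
near=> n.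
rewrite (@big_cat_nat _ _ _ J) //=; last first.
  by rewrite (leq_trans _ (leq_addl _ _)) //; near: n; exists J.
apply: le_lt_trans (ler_normD _ _) _; rewrite (splitr e) ltr_leD //.
  apply: le_lt_trans (ler_norm_sum _ _ _) _; apply: le_lt_trans (ler_norm _) _.
  by near: n; apply: (cvgr0_norm_lt _ headJ).
by apply: le_trans (ler_norm_sum _ _ _) _.
Unshelve. all: by end_near. Qed.

(** Dominated convergence for series: the tails of u n - l are bounded by those of h, uniformly in
    n. *)
Lemma tannery u l h (L : R) :
    (forall n j, (j < n)%N -> `|u n j - l j| <= h j) ->
    (forall j, u n j @[n --> \oo] --> l j) ->
    cvgn (series h) -> series l n @[n --> \oo] --> L ->
  (\sum_(0 <= j < n) u n j) @[n --> \oo] --> L.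
Proof.
move=> uh ul ch lL; rewrite -[L]add0r.
rewrite (_ : (fun n => _) = (fun n => \sum_(0 <= j < 0 + n) (u n j - l j) + series l n)).
  apply: cvgD lL; apply: (@cvg_sum_uniform_tail 0) => [j|e e_gt0].
    by rewrite -(subrr (l j)); apply: cvgB (ul j) (cvg_cst _).
  move/cauchy_cvgP/cauchy_seriesP: ch => /(_ e e_gt0) [[A B] /= [[J1 _ AJ] [J2 _ BJ]] sub].
  exists (maxn J1 J2) => n.
  have [le_nJ|lt_Jn] := leqP n (maxn J1 J2); first by rewrite big_geq // ltW.
  apply: ltW; apply: le_lt_trans (sub (maxn J1 J2, n) _); last first.
    by split; [apply: AJ => /= |apply: BJ => /=]; lia.
  rewrite /=; apply: le_trans (ler_norm _).
  rewrite big_nat [leRHS]big_nat; apply: ler_sum => j /andP[_ jn]; exact: uh.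
apply/funext => n; rewrite /series /= -big_split /=; apply: eq_bigr => j _.
by rewrite subrK.
Qed.

(** Beyond some J the values of q are small and the weights add up to at most K; below J each weight
    tends to 0. *)
Lemma toeplitz0 W q (K : R) :
    (forall n j, (j <= n)%N -> 0 <= W n j) ->
    (forall n, \sum_(0 <= j < n.+1) W n j <= K) ->
    (forall j, W n j @[n --> \oo] --> (0 : R)) ->
    q n @[n --> \oo] --> (0 : R) ->
  (\sum_(0 <= j < n.+1) W n j * q j) @[n --> \oo] --> (0 : R).
Proof.
move=> W_ge0 WK W0 q0; apply: (@cvg_sum_uniform_tail 1) => [j|e e_gt0].
  by rewrite -(mul0r (q j)); apply: cvgMl; apply: W0.
have K1 : 0 < `|K| + 1 by rewrite ltr_pwDr.
have [J _ qJ] : \forall n \near \oo, `|q n| < e / (`|K| + 1).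
  by move/cvgr0Pnorm_lt: q0; apply; rewrite divr_gt0.
exists J => n; have [le_nJ|lt_Jn] := leqP n.+1 J; first by rewrite big_geq // ltW.
apply: (@le_trans _ _ (\sum_(J <= j < n.+1) W n j * (e / (`|K| + 1)))).
  rewrite big_nat [leRHS]big_nat; apply: ler_sum => j /andP[Jj jn].
  rewrite normrM (ger0_norm (W_ge0 n j jn)); apply: ler_wpM2l; first exact: W_ge0.
  by apply: ltW; apply: qJ.
rewrite -mulr_suml mulrA ler_pdivrMr // mulrC ler_pM2l //.
apply: (@le_trans _ _ K); last by rewrite (le_trans (ler_norm _)) // lerDl.
apply: le_trans (WK n); rewrite [leRHS](@big_cat_nat _ _ _ J) //=; last exact: ltnW.
by rewrite lerDr big_nat; apply: sumr_ge0 => j /andP[_ jJ]; apply: W_ge0; lia.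
Qed.

End SummationLemmas.

(** * Values at u = 1 of products and exponentials of nonnegative series *)

Section NonnegativeSeries.
Variable R : realType.
Implicit Types (f g v : nat -> R).

Lemma series_fps_mul f g n : series (fps_mul f g) n =
  \sum_(0 <= i < n) f i * series g (n - i)%N.
Proof.
elim: n => [|n IHn]; first by rewrite /series /= !big_geq.
have Sn h k : series h k.+1 = series h k + h k :> R by rewrite /series /= big_nat_recr.
have S0 h : series h 0 = 0 :> R by rewrite /series /= big_geq.
rewrite Sn IHn /fps_mul -(big_mkord xpredT (fun i => f i * g (n - i)%N)).
have -> : \sum_(0 <= i < n) f i * series g (n - i)%N =
          \sum_(0 <= i < n.+1) f i * series g (n - i)%N.
  by rewrite big_nat_recr //= subnn S0 mulr0 addr0.
rewrite -big_split big_nat [RHS]big_nat; apply: eq_bigr => i /andP[_ le_in].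
by rewrite subSn // Sn mulrDr.
Qed.

Lemma series_ge0 f n : (forall k, 0 <= f k) -> 0 <= series f n.
Proof. by move=> f0; rewrite /series /= sumr_ge0. Qed.

Lemma series_le_lim f (F : R) n : (forall k, 0 <= f k) ->
  series f n @[n --> \oo] --> F -> series f n <= F.
Proof.
move=> f0 fF; rewrite -(cvg_lim _ fF) //; apply: nondecreasing_cvgn_le.
  by apply: nondecreasing_series => k _ _.
by apply/cvg_ex; exists F.
Qed.

(** By [tannery]: the partial sums of g lie between 0 and G, so f_i G dominates the differences. *)
Lemma cvg_series_fps_mul f g (F G : R) :
    (forall k, 0 <= f k) -> (forall k, 0 <= g k) ->
    series f n @[n --> \oo] --> F -> series g n @[n --> \oo] --> G ->
  series (fps_mul f g) n @[n --> \oo] --> F * G.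
Proof.
move=> f0 g0 fF gG; under eq_fun do rewrite series_fps_mul.
have cf : series (fun k => f k * G) n @[n --> \oo] --> F * G.
  under eq_fun do rewrite /series /= -mulr_suml; exact: cvgMl.
apply: (@tannery _ _ (fun i => f i * G) (fun i => f i * G)) => //.
- move=> n i _; rewrite -mulrBr normrM ger0_norm // distrC ger0_norm.
    by rewrite ler_wpM2l // gerBl series_ge0.
  by rewrite subr_ge0 series_le_lim.
- move=> i; apply: cvgMr; apply: (@cvg_addn_shift _ i _ _ _ _ gG) => n.
  by rewrite addnK.
- by apply/cvg_ex; exists (F * G).
Qed.

Lemma fps_pow_ge0 f m n : (forall k, 0 <= f k) -> 0 <= fps_pow f m n.
Proof.
move=> f0; elim: m n => [|m IHm] n; first exact: ler0n.
by apply: sumr_ge0 => i _; apply: mulr_ge0.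
Qed.

Lemma fps_exp_ge0 f n : (forall k, 0 <= f k) -> 0 <= fps_exp f n.
Proof.
by move=> f0; apply: sumr_ge0 => m _; rewrite divr_ge0 ?fps_pow_ge0 ?ler0n.
Qed.

Lemma cvg_series_fps_pow f (F : R) m : (forall k, 0 <= f k) ->
  series f n @[n --> \oo] --> F ->
  series (fps_pow f m) n @[n --> \oo] --> F ^+ m.
Proof.
move=> f0 fF; elim: m => [|m IHm]; last first.
  by rewrite exprS; apply: cvg_series_fps_mul => // k; apply: fps_pow_ge0.
rewrite -cvg_shiftS; apply: cvg_near_cst; near=> n.
by rewrite /series /= big_nat_recl //= big1 ?addr0.
Unshelve. all: by end_near. Qed.

(** By [tannery] again: the partial sums of v^m lie between 0 and V^m, so the exponential series of
    V dominates. *)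
Lemma cvg_series_fps_exp v (V : R) : v 0%N = 0 -> (forall k, 0 <= v k) ->
  series v n @[n --> \oo] --> V ->
  series (fps_exp v) n @[n --> \oo] --> expR V.
Proof.
move=> v0 v_ge0 vV; have V_ge0 : 0 <= V.
  by apply: le_trans (series_le_lim 0 v_ge0 vV); apply: series_ge0.
(* Exchange of summations; for coefficients of index below n the exponential may be cut at m < n. *)
have -> : series (fps_exp v) =
    (fun n => \sum_(0 <= m < n) series (fps_pow v m) n / m`!%:R).
  apply/funext => n; rewrite /series /=.
  under [RHS]eq_bigr do rewrite mulr_suml.
  rewrite exchange_big /= !big_nat; apply: eq_bigr => j /andP[_ jn].
  by rewrite (@fps_exp_wide _ _ _ n.-1) // ?big_mkord ?prednK //; lia.
apply: (@tannery _ _ (exp_coeff V) (exp_coeff V)).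
- move=> n m _; rewrite /exp_coeff /= -mulrBl normrM distrC [`|_ - _|]ger0_norm; last first.
    rewrite subr_ge0; apply: series_le_lim; last exact: cvg_series_fps_pow.
    by move=> k; apply: fps_pow_ge0.
  rewrite ger0_norm ?invr_ge0 ?ler0n // ler_wpM2r ?invr_ge0 ?ler0n // gerBl.
  by apply: series_ge0 => k; apply: fps_pow_ge0.
- by move=> m; apply: cvgMl; apply: cvg_series_fps_pow.
- exact: is_cvg_series_exp_coeff.
- exact: is_cvg_series_exp_coeff.
Qed.

End NonnegativeSeries.

(** * Coefficients of (1 - u)^(-x) times a summable series *)

Section LogSingularity.
Variables (R : realType) (x : R).
Hypothesis x_gt0 : 0 < x.

Let b n := fps_exp (fun j => x / j%:R) n.

Lemma fps_exp_log1_gt0 n : 0 < b n.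
Proof.
rewrite /b fps_exp_log1; apply: prodr_gt0 => i _.
by rewrite divr_gt0 ?ltr0n // ltr_wpDl ?ler0n.
Qed.

Lemma fps_exp_log1S n : n.+1%:R * b n.+1 = (n%:R + x) * b n.
Proof.
rewrite /b !fps_exp_log1 big_ord_recr /=.
have n0 : n.+1%:R != 0 :> R by rewrite pnatr_eq0.
by field; rewrite nat1r.
Qed.

(** Telescoping, since x b_n = (n+1) b_(n+1) - n b_n. *)
Lemma sum_fps_exp_log1 n : \sum_(0 <= m < n) b m = n%:R * b n / x.
Proof.
have x0 : x != 0 by rewrite gt_eqF.
elim: n => [|n IHn]; first by rewrite big_geq // !mul0r.
by rewrite big_nat_recr //= IHn fps_exp_log1S; field.
Qed.

Lemma natr_fps_exp_log1_homo : {homo (fun n => n%:R * b n) : m n / (m <= n)%N >-> m <= n}.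
Proof.
apply: homo_leq; [exact: lexx|exact: le_trans|move=> n].
rewrite fps_exp_log1S; apply: ler_wpM2r; first exact/ltW/fps_exp_log1_gt0.
by rewrite lerDl ltW.
Qed.

Lemma cvg_inv_natr : (n%:R^-1 : R) @[n --> \oo] --> (0 : R).
Proof. by rewrite -cvg_shiftS; apply: cvg_harmonic. Qed.

Lemma cvg_natr_ratio : ((n%:R : R) / (n%:R + x)) @[n --> \oo] --> (1 : R).
Proof.
have zero : ((n%:R + x)^-1 : R) @[n --> \oo] --> (0 : R).
  apply: (@squeeze_cvgr _ _ _ _ (fun=> 0) (fun n => n%:R^-1 : R)).
  - near=> n; have n_gt0 : 0 < n%:R :> R by rewrite ltr0n; near: n; exists 1%N.
    rewrite invr_ge0 addr_ge0 ?ler0n ?(ltW x_gt0) //=.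
    by rewrite lef_pV2 ?posrE ?addr_gt0 // lerDl ltW.
  - exact: cvg_cst.
  - exact: cvg_inv_natr.
have zerox : ((n%:R + x)^-1 * x) @[n --> \oo] --> 0 * x by apply: cvgMl.
apply: eq_cvg_pos (cvgB (cvg_cst (1 : R)) zerox); first by rewrite mul0r subr0.
move=> n _; have nx0 : n%:R + x != 0 by rewrite gt_eqF // ltr_wpDl ?ler0n.
by rewrite !fctE /=; field.
Unshelve. all: by end_near. Qed.

(** Raising j by one multiplies the quotient by m / (m + x) with m = n + j, which tends to 1. *)
Lemma fps_exp_log1_ratioD j :
  (n%:R * b n) / ((n + j)%N%:R * b (n + j)%N) @[n --> \oo] --> (1 : R).
Proof.
elim: j => [|j IHj].
  apply: cvg_near_cst; near=> n; rewrite addn0 divff // gt_eqF // mulr_gt0 //.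
    by rewrite ltr0n; near: n; exists 1%N.
  exact: fps_exp_log1_gt0.
have ratio : ((n + j)%N%:R / ((n + j)%N%:R + x)) @[n --> \oo] --> (1 : R).
  by have := cvg_natr_ratio; rewrite -(cvg_shiftn j).
apply: eq_cvg_pos (cvgM IHj ratio) => [|n n_gt0]; first by rewrite mulr1.
rewrite addnS fps_exp_log1S /GRing.mul_fun.
have bj0 : b (n + j)%N != 0 by rewrite gt_eqF // fps_exp_log1_gt0.
have nx0 : (n + j)%N%:R + x != 0 by rewrite gt_eqF // ltr_wpDl ?ler0n.
have nj0 : (n + j)%N%:R != 0 :> R by rewrite pnatr_eq0 -lt0n ltn_addr.
by move: (n + j)%N nj0 bj0 nx0 => m nj0 bj0 nx0; field; rewrite nj0 bj0 nx0.
Unshelve. all: by end_near. Qed.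

Lemma fps_exp_log1_ratio j :
  ((n - j)%N%:R * b (n - j)%N) / (n%:R * b n) @[n --> \oo] --> (1 : R).
Proof.
by apply: (@cvg_addn_shift _ j _ _ _ _ (fps_exp_log1_ratioD j)) => n; rewrite addnK.
Qed.

Lemma fps_exp_log1_negligible j :
  b (n - j)%N / (n%:R * b n) @[n --> \oo] --> (0 : R).
Proof.
have : b n / ((n + j)%N%:R * b (n + j)%N) @[n --> \oo] --> (0 : R).
  apply: eq_cvg_pos (cvgM (fps_exp_log1_ratioD j) cvg_inv_natr) => [|n n_gt0].
    by rewrite mulr0.
  have n0 : n%:R != 0 :> R by rewrite pnatr_eq0 -lt0n.
  have nj0 : (n + j)%N%:R != 0 :> R by rewrite pnatr_eq0 -lt0n ltn_addr.
  have bj0 : b (n + j)%N != 0 by rewrite gt_eqF // fps_exp_log1_gt0.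
  rewrite /GRing.mul_fun; move: (n + j)%N nj0 bj0 => m nj0 bj0.
  by field; rewrite nj0 bj0 n0.
by apply: (@cvg_addn_shift _ j) => n; rewrite addnK.
Qed.

Variables (v : nat -> R) (V : R).
Hypothesis v0 : v 0%N = 0.
Hypothesis v_ge0 : forall k, 0 <= v k.
Hypothesis vV : series v n @[n --> \oo] --> V.
Hypothesis kv0 : k%:R * v k @[k --> \oo] --> (0 : R).

Let h := fps_exp v.

(** The recursion writes n h_n as the sum of h_(n-k) (k v_k): weights of total at most exp(V)
    applied to a null sequence. *)
Lemma natr_fps_exp_cvg0 : n%:R * h n @[n --> \oo] --> (0 : R).
Proof.
have h_ge0 k : 0 <= h k by apply: fps_exp_ge0.
have hV := cvg_series_fps_exp v0 v_ge0 vV.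
rewrite (_ : (fun n => _) = (fun n => \sum_(0 <= k < n.+1) h (n - k)%N * (k%:R * v k))).
  apply: (@toeplitz0 _ (fun n k => h (n - k)%N) _ (expR V)) => //.
    move=> n; rewrite (_ : \sum_(_ <= _ < _) _ = series h n.+1).
      exact: series_le_lim.
    rewrite /series /= !big_mkord (reindex_inj rev_ord_inj); apply: eq_bigr => i _ /=.
    by rewrite subSS subKn // -ltnS.
  move=> j; have : h n @[n --> \oo] --> (0 : R).
    by apply: cvg_series_cvg_0; apply/cvg_ex; exists (expR V).
  by apply: (@cvg_addn_shift _ j) => n; rewrite addnK.
apply/funext => n; rewrite fps_exp_rec // big_mkord; apply: eq_bigr => k _.
by rewrite mulrC.
Qed.

(* Writing n = (n - j) + j in n * sum_j h_j b_(n-j), the first part is handled by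
   dominated summation since m * b_m increases, and the second is negligible
   since j * h_j tends to 0. *)
Lemma fps_exp_log_transfer :
  fps_exp (fun j => x / j%:R + v j) n / b n @[n --> \oo] --> expR V.
Proof.
have h_ge0 k : 0 <= h k by apply: fps_exp_ge0.
have hV := cvg_series_fps_exp v0 v_ge0 vV.
have b_gt0 := fps_exp_log1_gt0.
pose S1 n := \sum_(0 <= j < n) h j * (((n - j)%N%:R * b (n - j)%N) / (n%:R * b n)).
pose S2 n := \sum_(0 <= j < n.+1) b (n - j)%N / (n%:R * b n) * (j%:R * h j).
have S1V : S1 n @[n --> \oo] --> expR V.
  apply: (@tannery _ _ h h) => //; last 2 first.
  - move=> j; rewrite -[h j in X in _ --> X]mulr1; apply: cvgMr.
    exact: fps_exp_log1_ratio.
  - by apply/cvg_ex; exists (expR V).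
  move=> n j lt_jn; rewrite -[X in _ - X]mulr1 -mulrBr normrM ger0_norm //.
  rewrite -[leRHS]mulr1 ler_wpM2l // distrC.
  have nb_gt0 : 0 < n%:R * b n by rewrite mulr_gt0 // ltr0n; case: n lt_jn.
  rewrite ger0_norm; first by rewrite gerBl divr_ge0 ?mulr_ge0 ?ler0n ?ltW.
  rewrite subr_ge0 ler_pdivrMr // mul1r.
  exact: (natr_fps_exp_log1_homo (leq_subr j n)).
have S20 : S2 n @[n --> \oo] --> (0 : R).
  (* By [sum_fps_exp_log1] the weights add up to 1/x + 1/n for n > 0; for n = 0 they are quotients
     by 0, hence 0. *)
  apply: (@toeplitz0 _ (fun n j => b (n - j)%N / (n%:R * b n)) _ (x^-1 + 1)).
  - by move=> n j _; rewrite divr_ge0 ?mulr_ge0 ?ler0n ?ltW.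
  - move=> n; rewrite -mulr_suml.
    have -> : \sum_(0 <= j < n.+1) b (n - j)%N = \sum_(0 <= j < n.+1) b j.
      rewrite !big_mkord (reindex_inj rev_ord_inj); apply: eq_bigr => i _ /=.
      by rewrite subSS subKn // -ltnS.
    rewrite big_nat_recr //= sum_fps_exp_log1.
    case: n => [|n]; first by rewrite mul0r invr0 mulr0 addr_ge0 // invr_ge0 ltW.
    have n0 : n.+1%:R != 0 :> R by rewrite pnatr_eq0.
    have bn0 : b n.+1 != 0 by rewrite gt_eqF.
    have x0 : x != 0 by rewrite gt_eqF.
    rewrite mulrDl (_ : _ / x / _ = x^-1); last by field; rewrite nat1r n0 bn0 x0.
    rewrite lerD2l (_ : b n.+1 / _ = n.+1%:R^-1); last by field; rewrite nat1r n0 bn0.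
    by rewrite invf_le1 ?ltr0n // ler1n.
  - exact: fps_exp_log1_negligible.
  - exact: natr_fps_exp_cvg0.
apply: eq_cvg_pos (cvgD S1V S20) => [|n n_gt0]; first by rewrite addr0.
have n0 : n%:R != 0 :> R by rewrite pnatr_eq0 -lt0n.
have bn0 : b n != 0 by rewrite gt_eqF.
rewrite fps_expD ?invr0 ?mulr0 // fps_mulC.
transitivity (n%:R * fps_mul h b n / (n%:R * b n)); last by field; rewrite n0 bn0.
rewrite fps_mul_natl mulrDl [RHS]addrC; congr (_ + _).
  rewrite /fps_mul mulr_suml -(big_mkord xpredT
    (fun i => h i * ((n - i)%N%:R * b (n - i)%N) / (n%:R * b n))) big_nat_recr //=.
  by rewrite subnn !(mul0r, mulr0) addr0; apply: eq_bigr => j _; rewrite mulrA.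
rewrite /fps_mul mulr_suml /S2 big_mkord; apply: eq_bigr => j _.
by rewrite mulrC mulrA.
Qed.

End LogSingularity.

(** * Zeta values and the comparison with (1 - u)^(-1/a) *)

Section WreathAsymptotics.
Variable R : realType.

Lemma cvg_series_zeta r : (2 <= r)%N ->
  series (fun k => k%:R^-1 ^+ r) n @[n --> \oo] --> riemann_zeta (r%:R : R).
Proof.
move=> r_ge2; pose u k : R := k.+1%:R^-1 ^+ r.
have u_ge0 k : 0 <= u k by rewrite exprn_ge0 ?invr_ge0 ?ler0n.
have zetaE : (fun k => (k.+1%:R `^ (r%:R : R))^-1) = u.
  by apply/funext => k; rewrite powR_mulrn ?ler0n // /u exprVn.
(* Telescoping bound from 1/(m+1)^2 <= 1/m - 1/(m+1); the first term is 1 = 2 - 1. *)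
have bound n : series u n.+1 <= 2 - n.+1%:R^-1.
  elim: n => [|n IHn].
    by rewrite /series /= big_nat1 /u invr1 expr1n; lra.
  rewrite /series /= big_nat_recr //=; apply: le_trans (lerD IHn (lexx _)) _.
  have le1 : u n.+1 <= n.+2%:R^-1 ^+ 2.
    by apply: ler_wiXn2l => //; rewrite ?invr_ge0 ?ler0n // invf_le1 ?ltr0n ?ler1n.
  have le2 : n.+2%:R^-1 ^+ 2 <= n.+1%:R^-1 - n.+2%:R^-1 :> R.
    have n1 : 0 < n.+1%:R :> R by rewrite ltr0n.
    have -> : n.+2%:R = n.+1%:R + 1 :> R by rewrite natr1.
    move: (n.+1%:R) n1 => y y_gt0.
    have -> : y^-1 - (y + 1)^-1 = y^-1 * (y + 1)^-1.
      by field; rewrite !gt_eqF // addr_gt0.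
    rewrite expr2; apply: ler_wpM2r; first by rewrite invr_ge0 addr_ge0 ?ltW.
    by rewrite lef_pV2 ?posrE ?addr_gt0 // lerDl.
  by have := le_trans le1 le2; move: (u _) (n.+1%:R^-1) (n.+2%:R^-1) => w y z; lra.
have cu : cvgn (series u).
  apply: nondecreasing_is_cvgn; first by apply: nondecreasing_series => k _ _.
  exists 2 => _ [n _ <-]; apply: (@le_trans _ _ (series u n.+1)).
    by rewrite [leRHS]/series /= big_nat_recr //= lerDl.
  by rewrite (le_trans (bound n)) // gerBl invr_ge0 ler0n.
(* The term k = 0 is 0, as 0^-1 = 0 and r > 0, so this is the zeta series shifted by one index. *)
rewrite /riemann_zeta zetaE; apply: (@cvg_addn_shift _ 1%N) cu => n.
rewrite addn1 /series /= big_nat_recl //= invr0 expr0n.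
by rewrite (gtn_eqF (ltnW r_ge2)) add0r.
Qed.

Variables (a : nat).
Hypothesis a_ge2 : (2 <= a)%N.

Let p := cycle_proportion R a.
Let v (k : nat) : R := \sum_(2 <= r < a.+1) p r * k%:R^-1 ^+ r.

Lemma cycle_proportion_ge0 r : 0 <= p r.
Proof. by rewrite divr_ge0 ?ler0n. Qed.

(** For j > 0 the term r = 1 is split off, using p(a,1) = 1/a; at j = 0 both sides are 0 because
    0^-1 = 0. *)
Lemma wreath_exponent_split :
  wreath_exponent R a = fun j => a%:R^-1 / j%:R + v j.
Proof.
have a_gt0 : (0 < a)%N by apply: ltnW.
apply/funext => -[|j].
  rewrite /wreath_exponent /v /= invr0 mulr0 add0r big_nat big1 // => r /andP[r2 _].
  by rewrite expr0n (gtn_eqF (ltnW r2)) mulr0.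
rewrite wreath_exponent_cycle_proportion // big_ltn //.
by rewrite cycle_proportion1 // expr1.
Qed.

Lemma wreath_coef_ratio :
  fps_exp (wreath_exponent R a) n / \prod_(i < n) ((i%:R + a%:R^-1) / i.+1%:R)
   @[n --> \oo] -->
  expR (\sum_(2 <= r < a.+1) cycle_proportion R a r * riemann_zeta (r%:R : R)).
Proof.
under eq_fun do rewrite -fps_exp_log1 wreath_exponent_split.
apply: fps_exp_log_transfer.
- by rewrite invr_gt0 ltr0n ltnW.
- rewrite /v big_nat big1 // => r /andP[r2 _].
  by rewrite invr0 expr0n (gtn_eqF (ltnW r2)) mulr0.
- move=> k; apply: sumr_ge0 => r _.
  by rewrite mulr_ge0 ?cycle_proportion_ge0 ?exprn_ge0 ?invr_ge0 ?ler0n.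
(* The range of r is repeated as a predicate so that the termwise limits may use r >= 2. *)
- rewrite (_ : (fun n => _) = (fun n => \sum_(2 <= r < a.+1 | (2 <= r < a.+1)%N)
      p r * series (fun k => k%:R^-1 ^+ r) n)); last first.
    apply/funext => n; rewrite -big_nat /series /v /= exchange_big /=.
    by apply: eq_bigr => r _; rewrite mulr_sumr.
  rewrite big_nat; apply: cvg_sum_seq => r /andP[r2 _]; apply: cvgMr.
  exact: cvg_series_zeta.
- rewrite (_ : (fun n => _) = (fun n => \sum_(2 <= r < a.+1 | (2 <= r < a.+1)%N)
      p r * (n%:R * n%:R^-1 ^+ r))); last first.
    apply/funext => n; rewrite -big_nat /v mulr_sumr.
    by apply: eq_bigr => r _; rewrite mulrCA.
  rewrite [X in _ --> X](_ : _ = \sum_(2 <= r < a.+1 | (2 <= r < a.+1)%N) p r * 0); last first.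
    by rewrite big1 // => r _; rewrite mulr0.
  apply: cvg_sum_seq => -[|[|r]] // _; apply: cvgMr.
  (* The exponent is now r + 2, and n n^(-r-2) <= 1/n for n > 0. *)
  apply: (@squeeze_cvgr _ _ _ _ (fun=> 0) (fun n => n%:R^-1 : R)).
  + near=> n; have n_gt0 : (0 < n)%N by near: n; exists 1%N.
    have n0 : n%:R != 0 :> R by rewrite pnatr_eq0 -lt0n.
    rewrite exprS mulrA divff // mul1r exprn_ge0 ?invr_ge0 ?ler0n //= exprS.
    rewrite ler_piMr ?invr_ge0 ?ler0n // exprn_ile1 ?invr_ge0 ?ler0n //.
    by rewrite invf_le1 ?ltr0n ?ler1n.
  + exact: cvg_cst.
  + exact: cvg_inv_natr.
Unshelve. all: by end_near. Qed.

End WreathAsymptotics.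

(** * Euler's limit for the gamma function at 1/a *)

Section EulerLimit.
Variables (R : realType) (a : nat).
Hypothesis a_gt0 : (0 < a)%N.

Local Notation mu := (@lebesgue_measure R).
Let x : R := a%:R^-1.

Let x_gt0 : 0 < x. Proof. by rewrite invr_gt0 ltr0n. Qed.

Let a_neq0 : a%:R != 0 :> R. Proof. by rewrite pnatr_eq0 -lt0n. Qed.

Lemma integral_horner (p q : {poly R}) (c : R) : 0 < c -> q^`()%R = p ->
  (\int[mu]_(s in `[0%R, c]) (p.[s])%:E = (q.[c] - q.[0])%:E)%E.
Proof.
move=> c_gt0 qp; rewrite EFinB; apply: continuous_FTC2 => //.
- by apply: continuous_subspaceT; apply: continuous_horner.
- split; first by move=> s _; apply: derivable_horner.
    by apply: cvg_at_right_filter; apply: continuous_horner.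
  by apply: cvg_at_left_filter; apply: continuous_horner.
- by move=> s _; rewrite -derivE qp.
Qed.

Lemma euler_antiderivative n (C : R) : exists q : {poly R},
  [/\ q^`()%R = (C%:P - 'X^a) ^+ n, q.[0] = 0
    & forall c, c ^+ a = C ->
        q.[c] = c * C ^+ n * \prod_(i < n) (i.+1%:R / (i.+1%:R + x))].
Proof.
elim: n => [|n [q [dq q0 qc]]].
  exists 'X; rewrite derivX expr0 hornerX; split=> // c _.
  by rewrite hornerX expr0 big_ord0 !mulr1.
pose u : {poly R} := C%:P - 'X^a; pose k : R := 1 + a%:R * n.+1%:R.
have k0 : k != 0 by rewrite gt_eqF // ltr_pwDl // mulr_ge0 ?ler0n.
(* Integration by parts: as X^a = C - u, the derivative of X u^(n+1) is k u^(n+1) - a (n+1) C u^n,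
   and the multiple of q cancels the last term. At c only q contributes, since u vanishes there. *)
exists (k^-1 *: ('X * u ^+ n.+1 + (n.+1%:R * a%:R * C) *: q)).
split; last 2 first.
- by rewrite hornerZ hornerD hornerM hornerX mul0r hornerZ q0 mulr0 addr0 mulr0.
- move=> c cC; rewrite hornerZ hornerD hornerM hornerX hornerZ (qc _ cC) horner_exp /u.
  rewrite hornerD hornerN hornerC hornerXn cC subrr expr0n mulr0 add0r.
  rewrite big_ord_recr /= exprS; set Q := \prod_(i < n) _.
  have -> : n.+1%:R / (n.+1%:R + x) = n.+1%:R * a%:R / k.
    have : n.+1%:R + x != 0 by rewrite gt_eqF // ltr_wpDl ?ler0n.
    have -> : k = a%:R * (n.+1%:R + x) by rewrite /k /x mulrDr mulfV // addrC.
    by move: (n.+1%:R + x) (n.+1%:R : R) => y m y0; field; rewrite y0 a_neq0.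
  by move: (n.+1%:R : R) => m; field.
have XuE : 'X * 'X^(a.-1) = C%:P - u :> {poly R}.
  by rewrite -exprS prednK // /u opprB addrC subrK.
rewrite derivZ derivD derivM derivX mul1r derivZ dq -/u deriv_exp /= derivB derivC derivXn.
have -> : 'X * ((0 - 'X^(a.-1) *+ a) * u ^+ n *+ n.+1) =
    (a%:R * n.+1%:R) *: (u ^+ n.+1 - C%:P * u ^+ n).
  have -> : u ^+ n.+1 - C%:P * u ^+ n = - ('X * 'X^(a.-1) * u ^+ n).
    by rewrite XuE exprS; ring.
  rewrite -[_ *+ n.+1]mulr_natl -['X^_ *+ a]mulr_natl -mul_polyC -natrM polyC_natr natrM.
  by move: ('X^(a.-1)) (u ^+ n) (a%:R : {poly R}) (n.+1%:R : {poly R}) => Y W b m; ring.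
apply: (scalerI k0); rewrite scalerA mulfV // scale1r -!mul_polyC /k.
rewrite polyCD !polyCM; ring.
Qed.

(** Case C = n, c = n^(1/a) of [euler_antiderivative], rescaled by n^(-n). *)
Lemma integral_euler n : (0 < n)%N ->
  (\int[mu]_(s in `[0%R, (n%:R `^ x)%R]) ((1 - s ^+ a / n%:R) ^+ n)%R%:E =
   (n%:R `^ x * \prod_(i < n) (i.+1%:R / (i.+1%:R + x)))%R%:E)%E.
Proof.
move=> n_gt0; have n0 : n%:R != 0 :> R by rewrite pnatr_eq0 -lt0n.
have c_gt0 : 0 < n%:R `^ x :> R by rewrite powR_gt0 // ltr0n.
have cC : (n%:R `^ x) ^+ a = n%:R :> R.
  by rewrite -powR_mulrn ?powR_ge0 // -powRrM /x mulVf // powRr1 ?ler0n.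
have [q [dq q0 qc]] := euler_antiderivative n n%:R.
pose p : {poly R} := (n%:R ^- n) *: (n%:R%:P - 'X^a) ^+ n.
have dp : (n%:R ^- n *: q)^`()%R = p by rewrite derivZ dq.
have -> : (fun s : R => ((1 - s ^+ a / n%:R) ^+ n)%:E) = (fun s => (p.[s])%:E).
  apply/funext => s; congr EFin; rewrite /p hornerZ horner_exp hornerD hornerN hornerC.
  by rewrite hornerXn -exprVn -exprMn mulrBr mulVf // mulrC.
rewrite (integral_horner c_gt0 dp) !hornerZ q0 mulr0 subr0 (qc _ cC); congr EFin.
by rewrite mulrA mulrCA mulVf ?expf_neq0 // mulr1.
Qed.

(** With z = y/n, the bound 1 + z <= exp(z) gives exp(-z) (1 - z^2) <= 1 - z; its n-th power and
    Bernoulli's inequality leave an error of at most n z^2. *)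
Lemma exp_bernoulli_le n (y : R) : (0 < n)%N -> 0 <= y <= n%:R ->
  0 <= expR (- y) - (1 - y / n%:R) ^+ n <= y ^+ 2 / n%:R.
Proof.
move=> n_gt0 /andP[y_ge0 y_le]; have n_pos : 0 < n%:R :> R by rewrite ltr0n.
pose z := y / n%:R.
have z_ge0 : 0 <= z by rewrite divr_ge0 // ltW.
have z_le1 : z <= 1 by rewrite ler_pdivrMr // mul1r.
have expE : expR (- y) = expR (- z) ^+ n.
  by rewrite -expRM_natr mulNr /z divfK // gt_eqF.
have z2 : 0 <= 1 - z ^+ 2 by rewrite subr_ge0 exprn_ile1.
have lo : expR (- z) * (1 - z ^+ 2) <= 1 - z.
  have -> : 1 - z = expR (- z) * ((1 - z) * expR z) by rewrite mulrCA -expRD addNr expR0 mulr1.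
  apply: ler_wpM2l; first exact: expR_ge0.
  have := expR_ge1Dx z; have : 0 <= 1 - z by rewrite subr_ge0.
  by move: (expR z) => e; nra.
have bern m : 1 - m%:R * z ^+ 2 <= (1 - z ^+ 2) ^+ m.
  elim: m => [|m IHm]; first by rewrite mul0r subr0 expr0.
  rewrite [leRHS]exprS; apply: (@le_trans _ _ ((1 - z ^+ 2) * (1 - m%:R * z ^+ 2))); last first.
    exact: ler_wpM2l.
  rewrite -natr1.
  have : 0 <= z ^+ 2 by rewrite exprn_ge0.
  have : 0 <= m%:R :> R by rewrite ler0n.
  by move: (z ^+ 2) (m%:R : R) => w k; nra.
rewrite expE -/z; apply/andP; split.
  rewrite subr_ge0; apply: lerXn2r; rewrite ?nnegrE ?subr_ge0 ?expR_ge0 //.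
  exact: expR_ge1Dx.
have le1 : expR (- z) ^+ n * (1 - n%:R * z ^+ 2) <= (1 - z) ^+ n.
  apply: (@le_trans _ _ ((expR (- z) * (1 - z ^+ 2)) ^+ n)).
    by rewrite [leRHS]exprMn; apply: ler_wpM2l; rewrite ?exprn_ge0 ?expR_ge0.
  by apply: lerXn2r; rewrite ?nnegrE ?subr_ge0 // mulr_ge0 ?expR_ge0.
have -> : y ^+ 2 / n%:R = n%:R * z ^+ 2.
  by rewrite /z; field; rewrite gt_eqF.
have e1 : expR (- z) ^+ n <= 1.
  by rewrite -expE -expR0 ler_expR oppr_le0.
have nz : 0 <= n%:R * z ^+ 2 by rewrite mulr_ge0 ?ler0n ?exprn_ge0.
move: le1 e1 nz; move: (expR (- z) ^+ n) (n%:R * z ^+ 2) ((1 - z) ^+ n) => e w b.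
by nra.
Qed.

Let E n : R := n%:R `^ x * \prod_(i < n) (i.+1%:R / (i.+1%:R + x)).
Let e (s : R) : R := expR (- s ^+ a).

Let continuous_e : continuous e.
Proof.
move=> s; apply: (@continuous_comp _ _ _ (fun s : R => - s ^+ a) expR).
  by apply: cvgN; apply: exprn_continuous.
exact: continuous_expR.
Qed.

Let measurable_e D : measurable_fun D e.
Proof. by apply: measurable_funTS; apply: continuous_measurable_fun. Qed.

(** An integrable majorant: s <= s^a if s >= 1, and otherwise s - 1 <= 0 <= s^a. *)
Lemma stretched_exp_le (s : R) : 0 <= s -> e s <= expR 1 * expR (- s).
Proof.
move=> s_ge0; rewrite -expRD ler_expR.
have [s_le1|s_gt1] := leP s 1.
  by have : 0 <= s ^+ a; [rewrite exprn_ge0|move: (s ^+ a) => w; lra].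
have : s <= s ^+ a by apply: ler_eXnr => //; apply: ltW.
by move: (s ^+ a) => w; lra.
Qed.

(** Dominated convergence for the integrands of [integral_euler], extended by 0 beyond n^(1/a). The
    index is n + 1 during the proof, which keeps denominators nonzero. *)
Lemma euler_limit_ereal : mu.-integrable `[0%R, +oo[ (EFin \o e) /\
  (E n)%:E @[n --> \oo] --> (\int[mu]_(s in `[0%R, +oo[) (e s)%:E)%E.
Proof.
pose c n : R := n.+1%:R `^ x.
pose q n (s : R) : R := (1 - s ^+ a / n.+1%:R) ^+ n.+1.
pose f_ n : R -> \bar R := (EFin \o q n) \_ `[0%R, c n].
(* For s >= 0 this is exp(1 - s), written with the exponential density to inherit its
   integrability. *)
pose g (s : R) : \bar R := ((expR 1)%:E * (exponential_pdf 1 s)%:E)%E.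
have cq n : continuous (q n).
  move=> s; apply: (@continuous_comp _ _ _ (fun s : R => 1 - s ^+ a / n.+1%:R)
    (fun y => y ^+ n.+1)); last exact: exprn_continuous.
  apply: cvgB; first exact: cvg_cst.
  by apply: cvgMl; apply: exprn_continuous.
have in_c n (s : R) : 0 <= s -> (s <= c n) = (s ^+ a <= n.+1%:R).
  move=> s_ge0; have -> : n.+1%:R = c n ^+ a.
    by rewrite -powR_mulrn ?powR_ge0 // -powRrM /x mulVf // powRr1 ?ler0n.
  by rewrite ler_pXn2r // nnegrE ?powR_ge0.
have qe n (s : R) : 0 <= s -> s <= c n ->
    0 <= e s - q n s <= (s ^+ a) ^+ 2 / n.+1%:R.
  move=> s_ge0; rewrite in_c // => s_le; apply: exp_bernoulli_le => //.
  by rewrite exprn_ge0.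
have q_ge0 n (s : R) : 0 <= s -> s <= c n -> 0 <= q n s.
  move=> s_ge0; rewrite in_c // => s_le; rewrite exprn_ge0 // subr_ge0.
  by rewrite ler_pdivrMr ?ltr0n // mul1r.
have [] := @dominated_convergence _ _ R mu `[0%R, +oo[%classic (measurable_itv _)
    f_ (EFin \o e) g.
- move=> n; apply/measurable_restrict => //.
  by apply/measurable_EFinP; apply: measurable_funTS; apply: continuous_measurable_fun.
- by apply/measurable_EFinP; apply: measurable_e.
- apply: aeW => s /=; rewrite in_itv /= andbT => s_ge0.
  apply: cvg_EFin.
    by apply: nearW => n; rewrite /f_ patchE; case: ifP.
  have -> : fine \o (f_ ^~ s) = (fun n => (q n \_ `[0%R, c n]) s).
    by apply/funext => n; rewrite /f_ /= !patchE; case: ifP.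
  have lim0 : (s ^+ a) ^+ 2 / n.+1%:R @[n --> \oo] --> (0 : R).
    by rewrite -(mulr0 ((s ^+ a) ^+ 2)); apply: cvgMr; apply: cvg_harmonic.
  apply: (@squeeze_cvgr _ _ _ _ (fun n => e s - (s ^+ a) ^+ 2 / n.+1%:R) (fun=> e s)).
  + near=> n.
    have sc : s <= c n.
      rewrite in_c //; near: n; have [N _ Nle] := nbhs_infty_ger (s ^+ a).
      exists N => // n /= Nn; apply: le_trans (Nle n Nn) _.
      by rewrite ler_nat.
    rewrite patchE ifT; last by rewrite inE /= in_itv /= s_ge0 sc.
    by have /andP[h1 h2] := qe n s s_ge0 sc; rewrite lerBlDr -lerBlDl h2 -subr_ge0.
  + rewrite -[X in _ --> X]subr0; apply: cvgB => //; exact: cvg_cst.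
  + exact: cvg_cst.
- apply: integrableZl => //.
  by apply: integrableS (integrable_exponential_pdf ltr01).
- apply: aeW => s n /=; rewrite in_itv /= andbT => s_ge0.
  rewrite /g exponential_pdfE // mul1r mulN1r -EFinM /f_ patchE.
  case: ifPn => [|_]; last by rewrite abse0 lee_fin mulr_ge0 ?expR_ge0.
  rewrite inE /= in_itv /= => /andP[_ sc]; rewrite lee_fin ger0_norm ?q_ge0 //.
  apply: le_trans (stretched_exp_le s_ge0).
  by have /andP[h1 _] := qe n s s_ge0 sc; rewrite -subr_ge0.
move=> ie _ lime; split=> //; rewrite -cvg_shiftS.
apply: cvg_trans lime; apply: near_eq_cvg; near=> n => /=.
rewrite /E -integral_euler //.
have -> : `[0%R, (n.+1%:R `^ x)%R]%classic = `[0%R, +oo[%classic `&` `[0%R, c n]%classic.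
  apply/seteqP; split => s /=; rewrite !in_itv /= andbT; last by case.
  by move=> sc; split=> //; case/andP: sc.
by rewrite integral_mkcondr.
Unshelve. all: by end_near. Qed.

Let Ie := (\int[mu]_(s in `[0%R, +oo[) (e s)%:E)%E.

Lemma stretched_exp_integral_fin_num : Ie \is a fin_num.
Proof.
by apply: integrable_fin_num; first exact: measurable_itv; case: euler_limit_ereal.
Qed.

Lemma stretched_exp_integral_gt0 : (0 < Ie)%E.
Proof.
have lt1 : (0 < \int[mu]_(s in `[0%R, 1%R]) (expR (- 1) : R)%:E)%E.
  rewrite integral_cst //= lebesgue_measure_itv /= lte_fin ltr01 oppr0 adde0 mule1.
  by rewrite lte_fin expR_gt0.
apply: lt_le_trans lt1 _.
apply: (@le_trans _ _ (\int[mu]_(s in `[0%R, 1%R]) (e s)%:E)%E).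
  apply: ge0_le_integral => //.
  - by apply/measurable_EFinP; apply: measurable_e.
  - move=> s /=; rewrite in_itv /= => /andP[s0 s1].
    by rewrite lee_fin ler_expR lerN2 exprn_ile1.
apply: ge0_subset_integral => //.
- by apply/measurable_EFinP; apply: measurable_e.
- by move=> s _; rewrite lee_fin expR_ge0.
- by move=> s /=; rewrite !in_itv /= andbT => /andP[].
Qed.

Lemma powR_cvgy (r : R) : 0 < r -> t `^ r @[t --> +oo] --> +oo.
Proof.
move=> r_gt0; apply/cvgryPge => A; near=> t.
apply: le_trans (ler_norm A) _.
have -> : `|A| = (`|A| `^ r^-1) `^ r.
  by rewrite -powRrM mulVf ?gt_eqF // powRr1.
have tA : `|A| `^ r^-1 <= t by near: t; apply: nbhs_pinfty_ge; apply: num_real.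
apply: (ge0_ler_powR (ltW r_gt0)); rewrite ?nnegrE ?powR_ge0 //.
Unshelve. all: by end_near. Qed.

Lemma cvg_powR (r t : R) : 0 < t -> z `^ r @[z --> t] --> t `^ r.
Proof.
move=> t_gt0; have /differentiable_continuous : differentiable (@powR R ^~ r) t.
  by apply/derivable1_diffP; apply: derivable_powR; rewrite in_itv /= t_gt0.
exact.
Qed.

(* Euler's integral is rewritten with t = s^a; the singularity of t^(x - 1) at 0
   is avoided by integrating from c ^+ a, with c then tending to 0. *)
Lemma gamma_substitution (c : R) : x < 1 -> 0 < c ->
  (\int[mu]_(s in `[c, +oo[) (e s)%:E =
   \int[mu]_(t in `[(c ^+ a)%R, +oo[) (x%:E * (t `^ (x - 1) * expR (- t))%R%:E))%E.
Proof.
move=> x_lt1 c_gt0; pose F : R -> R := @powR R ^~ x; pose A := c ^+ a.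
have A_gt0 : 0 < A by rewrite exprn_gt0.
have FA : F A = c.
  by rewrite /F /A -powR_mulrn ?ltW // -powRrM /x mulfV // powRr1 // ltW.
have dF t : 0 < t -> derive1 F t = x * t `^ (x - 1).
  by move=> t_gt0; rewrite powR_derive1 // in_itv /= t_gt0.
have cdF t : 0 < t -> {for t, continuous (derive1 F)}.
  move=> t_gt0; rewrite /prop_for /continuous_at dF //.
  apply: (@cvg_trans _ ((x * z `^ (x - 1)) @[z --> t])).
    by apply: near_eq_cvg; near=> z; rewrite dF //; near: z; apply: lt_nbhsr.
  have lim : x * z `^ (x - 1) @[z --> t] --> x * t `^ (x - 1).
    by apply: cvgM; [exact: cvg_cst|exact: cvg_powR].
  exact: lim.
(* The substitution is s = F(t) = t^x, increasing, with derivative x t^(x - 1), which tends to 0 at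
   infinity as x < 1. *)
rewrite -[in LHS]FA (@increasing_ge0_integration_by_substitutiony R F e A).
- apply: eq_integral => t; rewrite inE /= in_itv /= andbT => At.
  have t_gt0 : 0 < t by apply: lt_le_trans At.
  rewrite -EFinM; congr EFin; rewrite !fctE dF // /e /F.
  rewrite -powR_mulrn ?powR_ge0 // -powRrM /x mulVf // powRr1 ?ltW //; ring.
- move=> s t; rewrite !in_itv /= !andbT => As At st.
  by apply: gt0_ltr_powR => //; rewrite nnegrE ltW // (lt_le_trans A_gt0).
- move=> t; rewrite in_itv /= andbT => At; apply: cdF; exact: lt_trans At.
- by apply/cvg_ex; exists (derive1 F A); apply: cvg_at_right_filter; apply: cdF.
- apply/cvg_ex; exists (x * 0).
  apply: (@cvg_trans _ ((x * (t `^ (1 - x))^-1) @[t --> +oo])).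
    apply: near_eq_cvg; near=> t; have t_gt0 : 0 < t by near: t; apply: nbhs_pinfty_gt.
    by rewrite dF // -powRN opprB.
  apply: cvgMr; apply/gtr0_cvgV0; last by apply: powR_cvgy; rewrite subr_gt0.
  by near=> t; apply: powR_gt0; near: t; apply: nbhs_pinfty_gt.
- split=> [t|].
    by rewrite in_itv /= andbT => At; apply: derivable_powR; rewrite in_itv /= (lt_trans A_gt0).
  by apply: cvg_at_right_filter; apply: cvg_powR.
- exact: powR_cvgy.
- exact: continuous_subspaceT.
- by move=> s _; apply: expR_ge0.
Unshelve. all: by end_near. Qed.

(** This exhaustion serves both for the bounds 1/(n+1) and for their a-th powers. *)
Lemma bigcup_itv_bndy (u : nat -> R) : (forall n, 0 < u n <= n.+1%:R^-1) ->
  \bigcup_n `[u n, +oo[%classic = `]0%R, +oo[%classic.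
Proof.
move=> u_bnd; apply/seteqP; split => s /=.
  move=> [n _] /=; rewrite !in_itv /= !andbT; apply: lt_le_trans.
  by case/andP: (u_bnd n).
rewrite in_itv /= andbT => s_gt0.
have [N _ Nle] := near_infty_natSinv_lt (PosNum s_gt0).
exists N => //=; rewrite in_itv /= andbT.
by have /andP[_ uN] := u_bnd N; rewrite (le_trans uN) // ltW // (Nle N) /=.
Qed.

(** Take c = 1/(n+1) in [gamma_substitution]; by monotone convergence both sides tend to the
    integrals over ]0, +oo[. *)
Lemma euler_gamma_stretched_exp : x < 1 -> euler_gamma x = a%:R * fine Ie.
Proof.
move=> x_lt1.
pose G (t : R) : \bar R := (t `^ (x - 1) * expR (- t))%:E.
have G_ge0 t : (0 <= G t)%E by rewrite lee_fin mulr_ge0 ?powR_ge0 ?expR_ge0.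
have mG D : measurable_fun D G.
  apply/measurable_EFinP; apply: measurable_funTS; apply: measurable_funM.
    exact: measurable_powR.
  by apply: measurableT_comp => //; apply: measurableT_comp.
pose u (n : nat) : R := n.+1%:R^-1.
have u01 n : 0 < u n <= 1 by rewrite invr_gt0 ltr0n invf_le1 ?ltr0n ?ler1n.
have u_le m n : (m <= n)%N -> u n <= u m.
  by move=> mn; rewrite lef_pV2 ?posrE ?ltr0n // ler_nat.
have cvg_e : (\int[mu]_(s in `[u n, +oo[) (e s)%:E)%E @[n --> \oo] -->
    (\int[mu]_(s in `]0%R, +oo[) (e s)%:E)%E.
  rewrite -(@bigcup_itv_bndy u) => [|n]; last by rewrite lexx andbT; case/andP: (u01 n).
  apply: ge0_nondecreasing_set_cvg_integral => //.
  - move=> m n mn; apply/subsetPset => s /=; rewrite !in_itv /= !andbT.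
    by apply: le_trans; apply: u_le.
  - by move=> n; apply/measurable_EFinP; apply: measurable_e.
  - by move=> n s _; rewrite lee_fin expR_ge0.
have cvg_G : (\int[mu]_(s in `[(u n ^+ a)%R, +oo[) (x%:E * G s))%E @[n --> \oo] -->
    (\int[mu]_(s in `]0%R, +oo[) (x%:E * G s))%E.
  rewrite -(@bigcup_itv_bndy (fun n => u n ^+ a)) => [|n]; last first.
    have /andP[un0 un1] := u01 n; rewrite exprn_gt0 //=.
    by rewrite -(prednK a_gt0) exprS ler_piMr ?exprn_ile1 // ltW.
  apply: ge0_nondecreasing_set_cvg_integral => //.
  - move=> m n mn; apply/subsetPset => s /=; rewrite !in_itv /= !andbT.
    apply: le_trans; apply: lerXn2r; rewrite ?nnegrE ?u_le //.
      by case/andP: (u01 n) => /ltW.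
    by case/andP: (u01 m) => /ltW.
  - by move=> n; apply: measurable_funeM; apply: mG.
  - by move=> n s _; rewrite mule_ge0 // lee_fin ltW.
have IeE : (\int[mu]_(s in `]0%R, +oo[) (e s)%:E)%E = Ie.
  by rewrite integral_itv_obnd_cbnd //; apply/measurable_EFinP; apply: measurable_e.
have GE : (\int[mu]_(s in `]0%R, +oo[) (x%:E * G s))%E = Ie.
  have eG : (fun n => \int[mu]_(s in `[u n, +oo[) (e s)%:E)%E =
      (fun n => \int[mu]_(s in `[(u n ^+ a)%R, +oo[) (x%:E * G s))%E.
    by apply/funext => n; rewrite gamma_substitution //; case/andP: (u01 n).
  move: cvg_e; rewrite eG IeE => cvg_e'.
  exact: (cvg_unique _ cvg_G cvg_e').
move: GE; rewrite ge0_integralZl //; [|exact: mG|by rewrite lee_fin ltW].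
move=> /(congr1 (mule a%:R%:E)); rewrite muleA -EFinM mulfV // mul1e.
by rewrite /euler_gamma /Rintegral => ->; rewrite fineM // stretched_exp_integral_fin_num.
Qed.

Lemma euler_gamma_gt0 : x < 1 -> 0 < euler_gamma x.
Proof.
move=> x_lt1; rewrite euler_gamma_stretched_exp // mulr_gt0 ?ltr0n //.
apply: fine_gt0; rewrite stretched_exp_integral_gt0 /=.
by rewrite ltey_eq stretched_exp_integral_fin_num.
Qed.

Lemma euler_limit : x < 1 -> a%:R * E n @[n --> \oo] --> euler_gamma x.
Proof.
move=> x_lt1; rewrite euler_gamma_stretched_exp //; apply: cvgMr.
have [_] := euler_limit_ereal.
by rewrite -/Ie -(fineK stretched_exp_integral_fin_num) => /fine_cvgP[_].
Qed.

(** The quotient equals n / (n + x) times the inverse of a E_n, so Euler's limit applies. *)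
Lemma binomial_coef_asymp : x < 1 ->
  (\prod_(i < n) ((i%:R + x) / i.+1%:R)) / n%:R `^ (x - 1)
    @[n --> \oo] --> (euler_gamma x)^-1.
Proof.
move=> x_lt1; have g0 : euler_gamma x != 0 by rewrite gt_eqF // euler_gamma_gt0.
have limV : (a%:R * E n)^-1 @[n --> \oo] --> (euler_gamma x)^-1.
  by apply: cvgV => //; apply: euler_limit.
apply: eq_cvg_pos (cvgM (cvg_natr_ratio x_gt0) limV) => [|n n_gt0].
  by rewrite mul1r.
have nx_gt0 m : 0 < m%:R + x by rewrite ltr_wpDl ?ler0n.
(* The factors i + 1 cancel, and so do the factors i + x except the one at i = 0. *)
have prodE : (\prod_(i < n) ((i%:R + x) / i.+1%:R)) * (n%:R + x) *
    \prod_(i < n) (i.+1%:R / (i.+1%:R + x)) = x.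
  elim: {n_gt0} n => [|n IHn]; first by rewrite !big_ord0 !mul1r mulr1 add0r.
  rewrite !big_ord_recr /= -[RHS]IHn.
  have n0 : n.+1%:R != 0 :> R by rewrite pnatr_eq0.
  have nx0 : n.+1%:R + x != 0 by rewrite gt_eqF.
  move: (\prod_(i < n) _) (\prod_(i < n) _) (n%:R + x) => P Q y.
  by move: (n.+1%:R : R) n0 nx0 => k k0 kx0; field; rewrite kx0 k0.
rewrite /E; move: prodE.
set P := \prod_(i < n) _; set Q := \prod_(i < n) _ => prodE.
have n_pos : 0 < n%:R :> R by rewrite ltr0n.
have Q0 : Q != 0.
  by rewrite gt_eqF // prodr_gt0 // => i _; rewrite divr_gt0 ?ltr0n.
have -> : P = x / ((n%:R + x) * Q).
  by rewrite -[X in _ = X / _]prodE -mulrA mulfK // mulf_neq0 // gt_eqF.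
have -> : n%:R `^ (x - 1) = n%:R `^ x / n%:R.
  by rewrite powRB ?(gt_eqF n_pos) ?implybT // powRr1 ?ler0n.
rewrite /x; move: (n%:R : R) n_pos => m m_gt0; field.
rewrite (gt_eqF m_gt0) (gt_eqF (powR_gt0 _ m_gt0)) a_neq0 Q0 /=.
by rewrite gt_eqF // addr_gt0 // mulr_gt0 // ltr0n.
Qed.

End EulerLimit.

Theorem theorem6p3 (R : realType) (a : nat) (a_ge2 : (2 <= a)%N) :
  (forall (n : nat) (P : {set {set 'I_(a * n)}}),
      is_block_system a n P ->
      conj_proportion R (block_stabilizer P)
        <= fps_exp (wreath_exponent R a) n)
  /\
  fps_exp (wreath_exponent R a) n
    / (expR (\sum_(2 <= r < a.+1) cycle_proportion R a r * riemann_zeta (r%:R : R))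
         / euler_gamma (a%:R^-1 : R) * n%:R `^ (a%:R^-1 - 1))
    @[n --> \oo] --> (1 : R).
Proof.
have a_gt0 : (0 < a)%N by apply: ltnW.
split=> [n P|]; first by apply: conj_proportion_le; rewrite ?card_ord.
have x_lt1 : a%:R^-1 < 1 :> R by rewrite invf_lt1 ?ltr0n ?ltr1n.
set S := expR _; set g := euler_gamma _.
have g0 : g != 0 by rewrite gt_eqF // euler_gamma_gt0.
have S0 : S != 0 by rewrite gt_eqF // expR_gt0.
(* The ratio is factored through the coefficient of (1 - u)^(-1/a), which turns it into a product of
   the two limits already obtained. *)
have lim : fps_exp (wreath_exponent R a) n / \prod_(i < n) ((i%:R + a%:R^-1) / i.+1%:R) *
    ((\prod_(i < n) ((i%:R + a%:R^-1) / i.+1%:R)) / n%:R `^ (a%:R^-1 - 1)) * (g / S)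
    @[n --> \oo] --> S * g^-1 * (g / S).
  apply: cvgMl; apply: cvgM; first exact: wreath_coef_ratio.
  exact: binomial_coef_asymp.
apply: eq_cvg_pos lim => [|n n_gt0]; first by field; rewrite g0 S0.
have B0 : \prod_(i < n) ((i%:R + a%:R^-1) / i.+1%:R) != 0 :> R.
  rewrite gt_eqF // prodr_gt0 // => i _.
  by rewrite divr_gt0 ?ltr0n // ltr_wpDl ?ler0n ?invr_gt0 ?ltr0n.
have p0 : n%:R `^ (a%:R^-1 - 1) != 0 :> R by rewrite gt_eqF // powR_gt0 // ltr0n.
move: (\prod_(i < n) _) (n%:R `^ _) B0 p0 => B p B0 p0.
by field; rewrite B0 p0 g0 S0.
Qed.
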